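(* Let $K\ge2$, let $u:\mathcal P_2(\mathbb R^K)\to\mathbb R$ be of class $\mathcal C^2$ (in the sense of the context), let $m\in\mathcal P_2(\mathbb R^K)$, $a\in\mathcal P(\{0,1\}^K)$ and $i\in[K]$. Write $$p=\int D_mu(m,x)\,m(dx),\quad Q=\int D_xD_mu(m,x)\,m(dx),\quad R=\iint D^2_{mm}u(m,x,y)\,m(dx)\,m(dy).$$ If $\hat a(i)>0$, then, with $\mathcal V_{a,i}=\sum_{j:\,i\in j}\frac{a(j)}{\hat a(i)}e_{j^c}$, $$\lim_{T\to\infty}T\left(u\big(A^{a,m}_{i,\sqrt T}\big)-u(m)+\frac1{\sqrt T}\mathcal V_{a,i}^\top p\right)=\frac12\sum_{j:\,i\in j}\frac{a(j)}{\hat a(i)}\,e_{j^c}^\top Q\,e_{j^c}+\frac12\sum_{k,j:\ i\in k,\ i\in j}\frac{a(j)}{\hat a(i)}\frac{a(k)}{\hat a(i)}\,e_{j^c}^\top R\,e_{k^c}.$$ If $\hat a(-i)>0$, then, with $\mathcal V_{a,-i}=\sum_{j:\,i\notin j}\frac{a(j)}{\hat a(-i)}e_{j}$, $$\lim_{T\to\infty}T\left(u\big(A^{a,m}_{-i,\sqrt T}\big)-u(m)-\frac1{\sqrt T}\mathcal V_{a,-i}^\top p\right)=\frac12\sum_{j:\,i\notin j}\frac{a(j)}{\hat a(-i)}\,e_{j}^\top Q\,e_{j}+\frac12\sum_{k,j:\ i\notin k,\ i\notin j}\frac{a(j)}{\hat a(-i)}\frac{a(k)}{\hat a(-i)}\,e_{j}^\top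 R\,e_{k}.$$
   Context: Notation: $[K]=\{1,\dots,K\}$; elements of $\{0,1\}^K$ are identified with subsets $j\subset[K]$, $j^c=[K]\setminus j$; $e_1,\dots,e_K$ is the canonical basis of $\mathbb R^K$ and $e_j=\sum_{i\in j}e_i$. For $a\in\mathcal P(\{0,1\}^K)$ (probability measures on $\{0,1\}^K$), $\hat a(i)=\sum_{j:i\in j}a(j)$, $\hat a(-i)=\sum_{j:i\notin j}a(j)$. $\mathcal P_2(\mathbb R^K)$ is the set of probability measures with finite second moment, with the 2-Wasserstein topology. For a finite measure $\mu$ on $\mathbb R^K$, $v\in\mathbb R^K$, $\lambda\in\mathbb R$: $\int f\,d\mu_{\sharp v}=\int f(x+v)\,\mu(dx)$ and $\int f\,d\mu^{*\lambda}=\int f(\lambda x)\,\mu(dx)$. Define $$A^{a,m}_{i,\sqrt T}=\Big(\sum_{j:\,i\in j}\big(\tfrac{a(j)}{\hat a(i)}m^{*\sqrt T}\big)_{\sharp -e_{j^c}}\Big)^{*\frac1{\sqrt T}},\qquad A^{a,m}_{-i,\sqrt T}=\Big(\sum_{j:\,i\notin j}\big(\tfrac{a(j)}{\hat a(-i)}m^{*\sqrt T}\big)_{\sharp e_{j}}\Big)^{*\frac1{\sqrt T}}.$$ Derivatives: $u:\mathcal P_2(\mathbb R^K)\to\mathbb R$ is Fréchet differentiable if there is a continuous $\frac{\delta u}{\delta m}:\mathcal P_2(\mathbb R^K)\times\mathbb R^K\to\mathbb R$ such that for all $m,m'\in\mathcal P_2(\mathbb R^K)$, $$\lim_{h\to0^+}\frac{u(m+h(m'-m))-u(m)}{h}=\int\frac{\delta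 u}{\delta m}(m,x)\,(m'-m)(dx)$$ (the integral being well defined). If $\frac{\delta u}{\delta m}$ is differentiable in $x$, $D_mu(m,x)=D_x\frac{\delta u}{\delta m}(m,x)\in\mathbb R^K$; $D_xD_mu(m,x)\in\mathbb R^{K\times K}$ is the $x$-derivative of $D_mu(m,x)$; and $D^2_{mm}u(m,x,y)\in\mathbb R^{K\times K}$ is obtained by applying $D_m$ (with new space variable $y$) componentwise to $m\mapsto D_mu(m,x)$ for fixed $x$, i.e. $D^2_{mm}u(m,x,y)=D_y\frac{\delta (D_mu(\cdot,x))}{\delta m}(m,y)$. $u$ is of class $\mathcal C^1$ if $D_mu$ exists, is continuous in $(m,x)$, and $|D_mu(m,x)|\le C(1+|x|^2)$. $u$ is of class $\mathcal C^2$ if it is $\mathcal C^1$ and $D_xD_mu(m,x)$, $D^2_{mm}u(m,x,y)$ exist, are continuous in all variables, and satisfy $|D_xD_mu(m,x)|\le C(1+|x|^2)$, $|D^2_{mm}u(m,x,y)|\le C(1+|x|^2+|y|^2)$ for a constant $C$. *)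

(* Defs.v *)
From HB Require Import structures.
From mathcomp Require Import all_boot all_order all_algebra.
From mathcomp Require Import all_classical all_reals all_analysis.
From mathcomp Require Import measurable_realfun ring lra.

Set Implicit Arguments.
Unset Strict Implicit.
Unset Printing Implicit Defensive.

Import Order.TTheory GRing.Theory Num.Theory.
Import numFieldNormedType.Exports.

Local Open Scope classical_set_scope.
Local Open Scope ring_scope.

Section Euclidean.
Context {R : realType}.

(* The library norm `|A| on matrices is the sup norm. *)
Definition l2norm {m n : nat} (A : 'M[R]_(m, n)) : R :=
  Num.sqrt (\sum_(k < m) \sum_(l < n) A k l ^+ 2).

Definition dot {n : nat} (v w : 'rV[R]_n) : R := (v *m w^T) 0 0.

(* Points are row vectors, so this is v^T Q w in column-vector notation. *)
Definition bilin {n : nat} (v : 'rV[R]_n) (Q : 'M[R]_n) (w : 'rV[R]_n) : R :=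
  (v *m Q *m w^T) 0 0.

(* e_j, the sum of the canonical basis vectors e_i over i in j *)
Definition evec {K : nat} (j : {set 'I_K}) : 'rV[R]_K :=
  \sum_(i in j) delta_mx 0 i.

End Euclidean.

Section Borel.
Context {R : realType} {n : nat}.
Let T := 'rV[R]_n.

Definition borel_display : measure_display. Proof. by constructor. Qed.

Let borel : set (set T) := <<s [set U : set T | open U] >>.
Let borel0 : borel set0. Proof. exact: sigma_algebra0. Qed.
Let borelC (A : set T) : borel A -> borel (~` A).
Proof. exact: sigma_algebraC. Qed.
Let borelU (F : (set T)^nat) : (forall k, borel (F k)) -> borel (\bigcup_k F k).
Proof. exact: sigma_algebra_bigcup. Qed.

HB.instance Definition _ := @isMeasurable.Build borel_display 'rV[R]_n
  borel borel0 borelC borelU.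

Lemma continuous_measurable_rV (f : T -> T) :
  continuous f -> measurable_fun setT f.
Proof.
move=> /continuousP cf.
apply: (measurability [set U : set T | open U]) => //.
move=> _ [A oA <-]; rewrite setTI.
by apply: sub_sigma_algebra; exact: cf.
Qed.

Lemma continuous_measurable_real (f : T -> R) :
  continuous f -> measurable_fun setT f.
Proof.
move=> /continuousP cf.
apply: (measurability _ (measurable_realfun.RGenOpens.measurableE R)).
move=> _ [_ [a [b ->]] <-]; rewrite setTI.
by apply: sub_sigma_algebra; apply: cf; exact: interval_open.
Qed.

Lemma sql2normE (x : T) : l2norm x ^+ 2 = \sum_(l < n) x 0 l ^+ 2.
Proof.
rewrite sqr_sqrtr; first by rewrite big_ord1.
by apply: sumr_ge0 => k _; apply: sumr_ge0 => l _; exact: sqr_ge0.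
Qed.

Lemma measurable_sql2norm : measurable_fun setT (fun x : T => l2norm x ^+ 2).
Proof.
under eq_fun do rewrite sql2normE.
apply: measurable_sum => l; apply: measurable_funX.
by apply: continuous_measurable_real => x; exact: coord_continuous.
Qed.

Lemma measurable_shift (v : T) : measurable_fun setT (fun x : T => x + v).
Proof.
apply: continuous_measurable_rV => x.
apply: (@cvgD _ _ _ (nbhs x) _ id (cst v) x v); first exact: cvg_id.
exact: cvg_cst.
Qed.

Lemma measurable_dilate (c : R) : measurable_fun setT (fun x : T => c *: x).
Proof. by apply: continuous_measurable_rV => x; exact: scaler_continuous. Qed.

End Borel.

Section FiniteMeasures.
Context {R : realType} {n : nat}.
Let T := 'rV[R]_n.
Local Notation meas := {measure set T -> \bar R}.
Implicit Types (mu nu : meas) (I : finType).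

(* mu_{# v} *)
Definition mshift mu (v : T) := pushforward mu (fun x : T => x + v).
HB.instance Definition _ mu v := Measure.copy (mshift mu v)
  (measure_function_pushforward__canonical__measure_function_Measure
    mu (measurable_shift v)).

(* mu^{* c} *)
Definition mdilate mu (c : R) := pushforward mu (fun x : T => c *: x).
HB.instance Definition _ mu c := Measure.copy (mdilate mu c)
  (measure_function_pushforward__canonical__measure_function_Measure
    mu (measurable_dilate c)).

Definition madd mu nu : meas := measure_add mu nu.

Lemma maddE mu nu (A : set T) : madd mu nu A = (mu A + nu A)%E.
Proof. exact: measure_addE. Qed.

Definition mbigadd I (P : pred I) (mu : I -> meas) : meas :=
  \big[madd/(mzero : meas)]_(i | P i) mu i.

Lemma mbigaddE I (P : pred I) (mu : I -> meas) (A : set T) :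
  mbigadd P mu A = (\sum_(i | P i) mu i A)%E.
Proof.
apply: (big_ind2 (fun (m : meas) x => m A = x)) => // m x m' y <- <-.
by rewrite maddE.
Qed.

Definition moment2 (mu : meas) : \bar R := (\int[mu]_x (l2norm x ^+ 2)%:E)%E.

Lemma measurable_Esql2norm :
  measurable_fun setT (fun x : T => (l2norm x ^+ 2)%:E).
Proof. by apply/measurable_EFinP; exact: measurable_sql2norm. Qed.

Lemma moment2_scale (c : {nonneg R}) mu :
  (moment2 mu < +oo -> moment2 (mscale c mu) < +oo)%E.
Proof.
move=> h; rewrite /moment2 ge0_integral_mscale//.
- by rewrite lte_mul_pinfty.
- exact: measurable_Esql2norm.
- by move=> x _; rewrite lee_fin sqr_ge0.
Qed.

Lemma moment2_add mu nu : (moment2 mu < +oo -> moment2 nu < +oo ->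
  moment2 (madd mu nu) < +oo)%E.
Proof.
move=> hm hm'; rewrite /moment2 ge0_integral_measure_add//.
- exact: lte_add_pinfty.
- by move=> x _; rewrite lee_fin sqr_ge0.
- exact: measurable_Esql2norm.
Qed.

Lemma moment2_bigadd I (P : pred I) (mu : I -> meas) :
  (forall i, P i -> moment2 (mu i) < +oo)%E -> (moment2 (mbigadd P mu) < +oo)%E.
Proof.
move=> h; apply: (big_ind (fun m => moment2 m < +oo)%E) => //.
- by rewrite /moment2 integral_measure_zero.
- by move=> m m'; exact: moment2_add.
Qed.

Lemma moment2_dilate mu c :
  (moment2 mu < +oo)%E -> (moment2 (mdilate mu c) < +oo)%E.
Proof.
move=> h; rewrite /moment2 ge0_integral_pushforward//=; last 3 first.
- exact: measurable_dilate.
- exact: measurable_Esql2norm.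
- by move=> x _; rewrite lee_fin sqr_ge0.
rewrite preimage_setT.
under eq_integral => x _.
  rewrite (_ : l2norm (c *: x) ^+ 2 = c ^+ 2 * l2norm x ^+ 2); last first.
    rewrite !sql2normE mulr_sumr; apply: eq_bigr => l _.
    by rewrite mxE exprMn.
  rewrite EFinM; over.
rewrite ge0_integralZl//=.
- by rewrite lte_mul_pinfty// lee_fin sqr_ge0.
- exact: measurable_Esql2norm.
- by move=> x _; rewrite lee_fin sqr_ge0.
- by rewrite lee_fin sqr_ge0.
Qed.

Lemma moment2_shift mu v : (mu setT < +oo)%E ->
  (moment2 mu < +oo)%E -> (moment2 (mshift mu v) < +oo)%E.
Proof.
move=> mu1 h; rewrite /moment2 ge0_integral_pushforward//=; last 3 first.
- exact: measurable_shift.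
- exact: measurable_Esql2norm.
- by move=> x _; rewrite lee_fin sqr_ge0.
rewrite preimage_setT.
apply: (@le_lt_trans _ _
  (\int[mu]_x (2%:E * (l2norm x ^+ 2)%:E + (2 * l2norm v ^+ 2)%:E))%E).
- apply: ge0_le_integral => //=.
  + by move=> x _; rewrite lee_fin sqr_ge0.
  + apply: (measurableT_comp (f := fun x : T => (l2norm x ^+ 2)%:E)).
      exact: measurable_Esql2norm.
    exact: measurable_shift.
  + apply: emeasurable_funD => //.
    by apply: measurable_funeM; exact: measurable_Esql2norm.
  + move=> x _; rewrite -EFinM -EFinD lee_fin !sql2normE !mulr_sumr.
    rewrite -big_split/=.
    apply: ler_sum => l _; rewrite mxE.
    have := sqr_ge0 (x 0 l - v 0 l); nra.
rewrite ge0_integralD//=.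
- rewrite ge0_integralZl//=.
  + rewrite integral_cst//=.
    apply: lte_add_pinfty; first by rewrite lte_mul_pinfty.
    by rewrite lte_mul_pinfty// lee_fin mulr_ge0// sqr_ge0.
  + exact: measurable_Esql2norm.
  + by move=> x _; rewrite lee_fin sqr_ge0.
- by move=> x _; rewrite -EFinM lee_fin mulr_ge0// sqr_ge0.
- by apply: measurable_funeM; exact: measurable_Esql2norm.
- by move=> x _; rewrite lee_fin mulr_ge0// sqr_ge0.
Qed.

(* Library measures are functions on all sets, so that two measures agreeing on
   the Borel sets need not be equal.  [mborel mu] is the representative of the
   measure [mu] that is zero on non-Borel sets. *)
Definition mborel (mu : set T -> \bar R) (A : set T) : \bar R :=
  if `[< measurable A >] then mu A else 0%E.

Lemma mborelE (mu : set T -> \bar R) (A : set T) :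
  measurable A -> mborel mu A = mu A.
Proof. by move=> mA; rewrite /mborel; case: asboolP. Qed.

Section mborel_measure.
Variable mu : meas.

Let mborel0 : mborel mu set0 = 0%E.
Proof. by rewrite mborelE. Qed.

Let mborel_ge0 A : (0 <= mborel mu A)%E.
Proof. by rewrite /mborel; case: asboolP. Qed.

Let mborel_sigma_additive : semi_sigma_additive (mborel mu).
Proof.
move=> F mF tF mUF; rewrite mborelE//.
under eq_fun do under eq_bigr do rewrite mborelE//.
exact: measure_semi_sigma_additive.
Qed.

HB.instance Definition _ := isMeasure.Build _ _ _ (mborel mu)
  mborel0 mborel_ge0 mborel_sigma_additive.

Definition pborel (h : mu setT = 1%E) := mborel mu.
HB.instance Definition _ h := Measure.on (pborel h).

Let pborelT h : pborel h setT = 1%E.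
Proof. by rewrite /pborel mborelE. Qed.

HB.instance Definition _ h := Measure_isProbability.Build _ _ _ (pborel h)
  (pborelT h).

End mborel_measure.

End FiniteMeasures.

Section P2.
Context (R : realType) (n : nat).
Let T := 'rV[R]_n.

(* The second field makes equality in P2 coincide with equality on Borel sets,
   see P2_ext. *)
Record P2 := MkP2 {
  P2_prob :> probability T R ;
  P2_out : forall A : set T, ~ measurable A -> P2_prob A = 0%E ;
  P2_moment2 : (moment2 P2_prob < +oo)%E }.

Lemma P2_ext (m m' : P2) :
  (forall A : set T, measurable A -> m A = m' A) -> m = m'.
Proof.
case: m m' => [p p0 p2] [q q0 q2]/= pq.
have epq : p = q.
  have {q2 p2} : p = q :> (set T -> \bar R).
    apply/funext => A.
    by have [/pq//|nA] := pselect (measurable A); rewrite p0// q0.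
  case: p q {p0 q0 pq} => [f [[a1 a2] [a3] [a4] [a5] [a6] [a7] [a8]]].
  move=> [g [[+ +] [+] [+] [+] [+] [+] [+]]] /= fg.
  rewrite -{}fg => b1 b2 b3 b4 b5 b6 b7 b8.
  rewrite (Prop_irrelevance a1 b1) (Prop_irrelevance a2 b2).
  rewrite (Prop_irrelevance a3 b3) (Prop_irrelevance a4 b4).
  rewrite (Prop_irrelevance a5 b5) (Prop_irrelevance a6 b6).
  by rewrite (Prop_irrelevance a7 b7) (Prop_irrelevance a8 b8).
subst q; rewrite (Prop_irrelevance p0 q0).
by rewrite (Prop_irrelevance p2 q2).
Qed.

HB.instance Definition _ := gen_eqMixin P2.
HB.instance Definition _ := gen_choiceMixin P2.

End P2.

Section P2_of.
Context {R : realType} {n : nat}.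
Variables (mu : {measure set 'rV[R]_n -> \bar R}).
Hypotheses (mu1 : mu setT = 1%E) (mu2 : (moment2 mu < +oo)%E).

Lemma P2_of_out (A : set 'rV[R]_n) : ~ measurable A -> pborel mu1 A = 0%E.
Proof. by rewrite /pborel /mborel; case: asboolP. Qed.

Lemma P2_of_moment2 : (moment2 (pborel mu1) < +oo)%E.
Proof.
rewrite /moment2 (eq_measure_integral mu)//.
by move=> A mA _; rewrite /= /pborel mborelE.
Qed.

Definition P2_of : P2 R n := MkP2 P2_of_out P2_of_moment2.

Lemma P2_ofE A : measurable A -> P2_of A = mu A.
Proof. exact: mborelE. Qed.

End P2_of.

Section Wasserstein.
Context {R : realType} {n : nat}.
Let T := 'rV[R]_n.

Definition coupling (m m' : P2 R n) : set (probability (T * T)%type R) :=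
  [set pi | forall A : set T, measurable A ->
    pi (A `*` setT) = m A /\ pi (setT `*` A) = m' A].

Definition W2 (m m' : P2 R n) : \bar R :=
  ereal_inf [set poweR (\int[pi]_z (l2norm (z.1 - z.2) ^+ 2)%:E)%E (2^-1)
            | pi in coupling m m'].

(* The topology of the distance W2, given by its open sets so that the triangle
   inequality is not needed. *)
Definition W2_open : set_system (P2 R n) :=
  [set U | forall m, U m ->
    exists2 e : R, 0 < e & forall m', (W2 m m' < e%:E)%E -> U m'].

Let W2_openT : W2_open setT.
Proof. by move=> m _; exists 1. Qed.

Let W2_openI : setI_closed W2_open.
Proof.
move=> U V oU oV m [/oU[e e0 eU] /oV[f f0 fV]].
exists (Num.min e f); first by rewrite lt_min e0.
by move=> m'; rewrite EFin_min lt_min => /andP[/eU ? /fV].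
Qed.

Let W2_open_bigU (I : Type) (F : I -> set (P2 R n)) :
  (forall i, W2_open (F i)) -> W2_open (\bigcup_i F i).
Proof.
move=> oF m [i _ /oF[e e0 eF]]; exists e => // m' /eF Fm'.
by exists i.
Qed.

HB.instance Definition _ := isOpenTopological.Build (P2 R n)
  W2_openT W2_openI W2_open_bigU.

End Wasserstein.

Section Segment.
Context {R : realType} {n : nat}.

Definition clip01 (h : R) : R := Num.max 0 (Num.min 1 h).

Lemma clip01_ge0 h : 0 <= clip01 h. Proof. by rewrite le_max lexx. Qed.

Lemma onem_clip01_ge0 h : 0 <= 1 - clip01 h.
Proof. by rewrite subr_ge0 ge_max ler01/= ge_min lexx. Qed.

Definition segment_meas (m m' : P2 R n) (h : R) :
    {measure set 'rV[R]_n -> \bar R} :=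
  madd (mscale (NngNum (onem_clip01_ge0 h)) m)
       (mscale (NngNum (clip01_ge0 h)) m').

Lemma segment_mass m m' h : segment_meas m m' h setT = 1%E.
Proof.
rewrite /segment_meas maddE /= /mscale/= !probability_setT !mule1.
by rewrite -EFinD subrK.
Qed.

Lemma segment_moment2 m m' h : (moment2 (segment_meas m m' h) < +oo)%E.
Proof.
by apply: moment2_add; apply: moment2_scale; exact: P2_moment2.
Qed.

(* m + h (m' - m) for h in [0, 1]; h is clipped to [0, 1] otherwise. *)
Definition segment (m m' : P2 R n) (h : R) : P2 R n :=
  P2_of (segment_mass m m' h) (segment_moment2 m m' h).

Lemma segmentE m m' h (A : set 'rV[R]_n) : 0 <= h <= 1 -> measurable A ->
  segment m m' h A = ((1 - h)%:E * m A + h%:E * m' A)%E.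
Proof.
move=> /andP[h0 h1] mA; rewrite P2_ofE//.
rewrite /segment_meas maddE /= /mscale/=.
by rewrite /clip01 (min_idPr h1) (max_idPr h0).
Qed.

End Segment.

Section Derivatives.
Context {R : realType} {n : nat}.
Let T := 'rV[R]_n.
Implicit Types (u : P2 R n -> R) (m : P2 R n) (x y : T).

(* The integral against m' - m is well defined for all m and m' if and only if
   d m is integrable against every m'. *)
Definition is_linear_derivative u (d : P2 R n -> T -> R) : Prop :=
  [/\ continuous (fun z : P2 R n * T => d z.1 z.2),
      forall m m', m'.-integrable setT (EFin \o d m) &
      forall m m', (fun h => (u (segment m m' h) - u m) / h) @ 0^'+ -->
        \int[m']_x d m x - \int[m]_x d m x].

Definition Frechet_differentiable u : Prop :=
  exists d, is_linear_derivative u d.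

(* The linear derivative is only unique up to a function of m; one is chosen,
   and D_m, which does not depend on the choice, is defined from it. *)
Definition linear_derivative u : P2 R n -> T -> R :=
  get (is_linear_derivative u).

Definition gradient (f : T -> R) (x : T) : T :=
  \row_k 'D_(delta_mx 0 k) f x.

Definition Dm u m x : T := gradient (linear_derivative u m) x.

(* jacobian has the derivatives of the k-th component in column k *)
Definition DxDm u m x : 'M[R]_n := (jacobian (Dm u m) x)^T.

Definition D2mm u m x y : 'M[R]_n :=
  \matrix_(k, l) Dm (fun m' => Dm u m' x 0 k) m y 0 l.

Definition classC1 u : Prop :=
  [/\ Frechet_differentiable u,
      forall m x, differentiable (linear_derivative u m) x,
      continuous (fun z : P2 R n * T => Dm u z.1 z.2) &
      exists C : R, forall m x, l2norm (Dm u m x) <= C * (1 + l2norm x ^+ 2)].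

Definition classC2 u : Prop :=
  [/\ classC1 u,
      [/\ forall m x, differentiable (Dm u m) x,
          forall x k, Frechet_differentiable (fun m => Dm u m x 0 k) &
          forall m x k y, differentiable
            (linear_derivative (fun m' => Dm u m' x 0 k) m) y],
      continuous (fun z : P2 R n * T => DxDm u z.1 z.2),
      continuous (fun z : P2 R n * T * T => D2mm u z.1.1 z.1.2 z.2) &
      exists C : R,
        (forall m x, l2norm (DxDm u m x) <= C * (1 + l2norm x ^+ 2)) /\
        (forall m x y,
          l2norm (D2mm u m x y) <= C * (1 + l2norm x ^+ 2 + l2norm y ^+ 2))].

End Derivatives.

Section Simplex.
Context {R : realType} {K : nat}.

(* P({0,1}^K), with {0,1}^K identified with the subsets of 'I_K *)
Record cubeP := MkCubeP {
  cubeP_fun :> {set 'I_K} -> R ;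
  cubeP_ge0 : forall j, 0 <= cubeP_fun j ;
  cubeP_sum : \sum_j cubeP_fun j = 1 }.

Implicit Types (a : cubeP) (m : P2 R K) (i : 'I_K) (s : R).

(* Suffix p: vertices j containing i, e.g. hatp a i is a^(i).
   Suffix n: vertices j not containing i, e.g. hatn a i is a^(-i). *)
Definition hatp a i : R :=
  \sum_(j : {set 'I_K} | i \in j) a j.
Definition hatn a i : R :=
  \sum_(j : {set 'I_K} | i \notin j) a j.

Definition Vp a i : 'rV[R]_K :=
  \sum_(j : {set 'I_K} | i \in j) (a j / hatp a i) *: evec (~: j).
Definition Vn a i : 'rV[R]_K :=
  \sum_(j : {set 'I_K} | i \notin j) (a j / hatn a i) *: evec j.

Lemma wp_ge0 a i j : 0 <= a j / hatp a i.
Proof.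
by rewrite divr_ge0 ?cubeP_ge0// sumr_ge0// => k _; exact: cubeP_ge0.
Qed.

Lemma wn_ge0 a i j : 0 <= a j / hatn a i.
Proof.
by rewrite divr_ge0 ?cubeP_ge0// sumr_ge0// => k _; exact: cubeP_ge0.
Qed.

Definition Ap_meas a m i s :
    {measure set 'rV[R]_K -> \bar R} :=
  mdilate (mbigadd (fun j : {set 'I_K} => i \in j) (fun j =>
    mshift (mscale (NngNum (wp_ge0 a i j)) (mdilate m s)) (- evec (~: j))))
  s^-1.

Definition An_meas a m i s :
    {measure set 'rV[R]_K -> \bar R} :=
  mdilate (mbigadd (fun j : {set 'I_K} => i \notin j) (fun j =>
    mshift (mscale (NngNum (wn_ge0 a i j)) (mdilate m s)) (evec j)))
  s^-1.

Lemma mix_mass (P : pred {set 'I_K}) (w : {set 'I_K} -> {nonneg R}) v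
    (m : P2 R K) s t : \sum_(j | P j) (w j)%:num = 1 ->
  mdilate (mbigadd P (fun j => mshift (mscale (w j) (mdilate m s)) (v j))) t
    setT = 1%E.
Proof.
move=> w1; rewrite /mdilate /pushforward preimage_setT mbigaddE.
rewrite -[1%E]/(1%:E) -w1 -sumEFin; apply: eq_bigr => j _.
rewrite /= /mshift /pushforward preimage_setT /mscale /=.
by rewrite /mdilate /pushforward preimage_setT probability_setT mule1.
Qed.

Lemma mix_moment2 (P : pred {set 'I_K}) (w : {set 'I_K} -> {nonneg R}) v
    (m : P2 R K) s t :
  (moment2 (mdilate (mbigadd P (fun j =>
    mshift (mscale (w j) (mdilate m s)) (v j))) t) < +oo)%E.
Proof.
apply: moment2_dilate; apply: moment2_bigadd => j _.
apply: moment2_shift; last first.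
  by apply: moment2_scale; apply: moment2_dilate; exact: P2_moment2.
rewrite /= /mscale /= /mdilate /pushforward preimage_setT probability_setT.
by rewrite mule1 ltry.
Qed.

Lemma Ap_mass a m i s : 0 < hatp a i -> Ap_meas a m i s setT = 1%E.
Proof.
move=> h; apply: mix_mass => /=.
by rewrite -mulr_suml divff// gt_eqF.
Qed.

Lemma An_mass a m i s : 0 < hatn a i -> An_meas a m i s setT = 1%E.
Proof.
move=> h; apply: mix_mass => /=.
by rewrite -mulr_suml divff// gt_eqF.
Qed.

(* Ap and An are A^{a,m}_{i,s} and A^{a,m}_{-i,s} as elements of P2. *)
Definition Ap a m i (h : 0 < hatp a i) s : P2 R K :=
  P2_of (Ap_mass m s h) (mix_moment2 _ _ _ m s s^-1).

Definition An a m i (h : 0 < hatn a i) s : P2 R K :=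
  P2_of (An_mass m s h) (mix_moment2 _ _ _ m s s^-1).

End Simplex.
Arguments cubeP : clear implicits.
Arguments Ap {R K a} m {i} h s.
Arguments An {R K a} m {i} h s.

(* Main.v *)
From HB Require Import structures.
From mathcomp Require Import all_boot all_order all_algebra.
From mathcomp Require Import all_classical all_reals all_analysis.
From mathcomp Require Import measurable_realfun ring lra.
Require Import Defs.

Set Implicit Arguments.
Unset Strict Implicit.
Unset Printing Implicit Defensive.

Import Order.TTheory GRing.Theory Num.Theory.
Import numFieldNormedType.Exports.

Local Open Scope classical_set_scope.
Local Open Scope ring_scope.

(** Let [mu_e] be the law of [X + e V], with [X] of law [m] and [V] an independent
vector with finitely many values; the two measures of the theorem are of this
form with [e = T^(-1/2)].  Along the segment [h |-> m + h (mu_e - m)] the function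
[u] is differentiable, with slope
  [phi(h) = E[d(m_h, X + e V) - d(m_h, X)]],  [d] the linear derivative of [u],
and Cauchy's mean value theorem against [h^2] gives, for some [t] in [(0, 1)],
  [u(mu_e) - u(m) = phi(0) + (phi(t) - phi(0)) / (2 t)].
A second order Taylor expansion in [x] of [d(m, .)] turns [phi(0)] into the terms
in [p] and [Q].  In [phi(t) - phi(0)] the mean value theorem is applied in [x], then
along the segment to each component of [D_m u(., x)], then in [y]; this yields
values of [D^2_mm u] at points converging to [(m, x, y)], hence the term in [R].
Since the quadratic growth bounds hold uniformly in the measure, both limits follow
by dominated convergence; the intermediate points need not depend measurably on
[x], because only the difference quotients are integrated. *)

(** * Mean value theorems *)

Section RealMeanValue.
Context {R : realType}.

(* Cauchy's mean value theorem against [t ^+ 2]; it is Rolle's theorem for the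
   remainder minus the multiple of [t ^+ 2] that makes it vanish at [b]. *)
Lemma second_order_MVT (f df : R -> R) (b c : R) : 0 < b ->
  (forall x, x \in `]0, b[ -> is_derive x 1 f (df x)) ->
  {within `[0, b], continuous f} ->
  exists2 x, x \in `]0, b[ & f b - f 0 - b * c = b ^+ 2 * ((df x - c) / (2 * x)).
Proof.
move=> b0 dfx cf.
pose k := (f b - f 0 - b * c) / b ^+ 2.
pose g (t : R) : R := f t - (t * c + k * (t * t)).
have [] := @MVT R g (fun t => df t - (c + k * (t + t))) 0 b b0.
- move=> x xb; have fx := dfx x xb.
  apply: is_deriveB; apply: is_deriveD.
    have := is_deriveM (is_derive_id x (1 : R)) (is_derive_cst c x (1 : R)).
    by rewrite /cst/= scaler0 add0r /GRing.scale/= mulr1.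
  have := is_deriveM (is_derive_cst k x (1 : R))
    (is_deriveM (is_derive_id x (1 : R)) (is_derive_id x (1 : R))).
  by rewrite /cst/= scaler0 addr0 /GRing.scale/= mulr1.
- move=> x; apply: cvgB; first exact: cf.
  apply: continuous_subspaceT x => x; apply: cvgD.
    by apply: cvgMl; exact: cvg_id.
  by apply: cvgMr; apply: cvgM; exact: cvg_id.
move=> x xb; rewrite /g => gE; exists x => //.
have [x0 _] : 0 < x /\ x < b by move: xb; rewrite in_itv/= => /andP.
have kE : k * b ^+ 2 = f b - f 0 - b * c by rewrite /k divfK// expf_neq0 ?gt_eqF.
have : (df x - (c + k * (x + x))) * b = 0.
  rewrite subr0 in gE; rewrite -gE -[LHS]add0r; ring: kE.
move/eqP; rewrite mulf_eq0 (gt_eqF b0) orbF => /eqP dfE.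
rewrite -kE mulrC; congr (_ * _).
have -> : df x - c = k * (2 * x) by lra.
by rewrite mulfK// gt_eqF// mulr_gt0.
Qed.

End RealMeanValue.

(** * Derivatives, mean value and Taylor formulas along lines *)

Section DirectionalDerivatives.
Context {R : realType} {n : nat}.
Implicit Types (x v w : 'rV[R]_n) (F : 'rV[R]_n -> 'rV[R]_n) (f : 'rV[R]_n -> R).

(** By [E], the difference quotient of the restriction to the line is the same function of [h] as
    the quotient of [f] in direction [v], so derivability and value transfer together. *)
Lemma is_derive_line (W : normedModType R) (f : 'rV[R]_n -> W) x v (t : R) :
  differentiable f (x + t *: v) ->
  is_derive t 1 (fun s : R => f (x + s *: v)) ('D_v f (x + t *: v)).
Proof.
move=> /(diff_derivable (v := v)) df.
have E : (fun h : R => h^-1 *: (((fun s : R => f (x + s *: v)) \o shift t)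
     (h *: (1 : R)) - f (x + t *: v))) =
   (fun h : R => h^-1 *: ((f \o shift (x + t *: v)) (h *: v)
     - f (x + t *: v))).
  apply/funext => h /=; congr (_ *: (f _ - _)).
  by rewrite scalerDl /GRing.scale/= mulr1 addrCA.
by split; rewrite /derivable /derive E.
Qed.

Lemma derive_gradient f x v : differentiable f x ->
  'D_v f x = dot v (gradient f x).
Proof.
move=> df; rewrite deriveE// {1}(row_sum_delta v) linear_sum/= /dot mxE.
by apply: eq_bigr => k _; rewrite linearZ/= !mxE deriveE.
Qed.

Lemma continuous_line (W : normedModType R) (f : 'rV[R]_n -> W) x v
    (i : interval R) : (forall y, differentiable f y) ->
  {within [set` i], continuous (fun s : R => f (x + s *: v))}.
Proof.
move=> df; apply: derivable_within_continuous => t _.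
by have [] := @is_derive_line _ f x v t (df _).
Qed.

Lemma line_MVT f x v (e : R) : 0 < e -> (forall y, differentiable f y) ->
  exists2 t, t \in `]0, e[ &
    f (x + e *: v) - f x = e * dot v (gradient f (x + t *: v)).
Proof.
move=> e0 df.
have [t _||t te] := @MVT R (fun s => f (x + s *: v))
  (fun s => dot v (gradient f (x + s *: v))) 0 e e0.
- by rewrite -derive_gradient//; exact: is_derive_line.
- exact: continuous_line.
by rewrite scale0r addr0 subr0 mulrC => E; exists t.
Qed.

Lemma dotE v w : dot v w = \sum_l v 0 l * w 0 l.
Proof. by rewrite /dot mxE; apply: eq_bigr => l _; rewrite mxE. Qed.

Lemma bilinE v (M : 'M[R]_n) w :
  bilin v M w = \sum_k \sum_l v 0 k * w 0 l * M k l.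
Proof.
rewrite /bilin mxE exchange_big/=; apply: eq_bigr => l _.
rewrite !mxE mulr_suml; apply: eq_bigr => k _; ring.
Qed.

(** Transposing does not change a quadratic form; the transpose is there so that for [F := Dm u m]
    the matrix is literally [DxDm u m]. *)
Lemma is_derive_dot v F x (t : R) : differentiable F (x + t *: v) ->
  is_derive t 1 (fun s : R => dot v (F (x + s *: v)))
    (bilin v (jacobian F (x + t *: v))^T v).
Proof.
move=> dF; have [dL vL] := @is_derive_line _ F x v t dF.
have dLl l : is_derive t 1 (fun s => F (x + s *: v) 0 l)
    ((v *m jacobian F (x + t *: v)) 0 l).
  split; first by have /derivable_mxP := dL; exact.
  by rewrite -deriveEjacobian// -vL derive_mx// mxE.
have -> : (fun s : R => dot v (F (x + s *: v))) =
    \sum_(l < n) (fun s : R => v 0 l *: F (x + s *: v) 0 l).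
  by apply/funext => s; rewrite dotE fct_sumE.
have dS := is_derive_sum (fun l => @is_deriveZ _ _ _ _ (v 0 l) _ _ _ (dLl l)).
have -> : bilin v (jacobian F (x + t *: v))^T v =
    \sum_(l < n) v 0 l *: (v *m jacobian F (x + t *: v)) 0 l.
  rewrite /bilin -mulmxA -trmx_mul mxE; apply: eq_bigr => l _.
  by rewrite [X in _ * X]mxE.
exact: dS.
Qed.

(** Cauchy's theorem leaves the increment of the first derivative over [[0, s]] divided by [2 s];
    the mean value theorem on that increment yields a factor [s], which cancels and leaves one
    half. *)
Lemma line_taylor2 f x v (e : R) : 0 < e -> (forall y, differentiable f y) ->
  (forall y, differentiable (gradient f) y) ->
  exists2 t, t \in `]0, e[ &
    f (x + e *: v) - f x - e * dot v (gradient f x) =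
    e ^+ 2 * (2^-1 * bilin v (jacobian (gradient f) (x + t *: v))^T v).
Proof.
move=> e0 df dg.
have [s _||s se] := @second_order_MVT R (fun s => f (x + s *: v))
  (fun s => dot v (gradient f (x + s *: v))) e (dot v (gradient f x)) e0.
- by rewrite -derive_gradient//; exact: is_derive_line.
- exact: continuous_line.
rewrite scale0r addr0 => ->.
have [s0 se'] : 0 < s /\ s < e by move: se; rewrite in_itv/= => /andP.
pose g s := dot v (gradient f (x + s *: v)).
have dgs (t : R) : is_derive t 1 g _ := @is_derive_dot v (gradient f) x t (dg _).
have [|t] := @MVT R g _ 0 s s0 (fun t _ => dgs t).
  by apply: derivable_within_continuous => t _; case: (dgs t).
rewrite in_itv/= => /andP[t0 ts]; rewrite /g scale0r addr0 subr0 => ->.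
exists t; first by rewrite in_itv/= t0 (lt_trans ts).
congr (_ * _); field; exact: lt0r_neq0.
Qed.

End DirectionalDerivatives.

(** * Combinations of measures and dominated convergence *)

Section MeasureCombination.
Context d (T : measurableType d) (R : realType) (I : finType).
Local Notation meas := {measure set T -> \bar R}.
Implicit Types (P : pred I) (c : I -> {nonneg R}) (mu : I -> meas).

Definition measure_comb P c mu : meas :=
  \big[(fun m1 m2 => measure_add m1 m2 : meas)/(mzero : meas)]_(i | P i)
    (mscale (c i) (mu i) : meas).

Lemma measure_combE P c mu (A : set T) :
  measure_comb P c mu A = (\sum_(i | P i) (c i)%:num%:E * mu i A)%E.
Proof.
apply: (big_ind2 (fun (m : meas) x => m A = x)) => // m x m' y <- <-.
exact: measure_addE.
Qed.

Lemma ge0_integral_measure_comb P c mu (f : T -> \bar R) :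
  measurable_fun setT f -> (forall x, 0 <= f x)%E ->
  (\int[measure_comb P c mu]_x f x =
   \sum_(i | P i) (c i)%:num%:E * \int[mu i]_x f x)%E.
Proof.
move=> mf f0.
apply: (big_ind2 (fun (m : meas) x => \int[m]_x f x = x)%E).
- by rewrite integral_measure_zero.
- by move=> m x m' y <- <-; rewrite ge0_integral_measure_add.
- by move=> i _; rewrite ge0_integral_mscale.
Qed.

Section integrable.
Variables (nu : meas) (P : pred I) (c : I -> {nonneg R}) (mu : I -> meas).
Hypothesis nuE : forall A : set T, measurable A ->
  nu A = (\sum_(i | P i) (c i)%:num%:E * mu i A)%E.

(** Integrals see only measurable sets, so [nuE] is asked on these alone: elements of [P2] vanish on
    non-Borel sets, where a combination of measures may not. *)
Lemma ge0_integral_comb (f : T -> \bar R) :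
  measurable_fun setT f -> (forall x, 0 <= f x)%E ->
  (\int[nu]_x f x = \sum_(i | P i) (c i)%:num%:E * \int[mu i]_x f x)%E.
Proof.
move=> mf f0; rewrite -ge0_integral_measure_comb//.
apply: eq_measure_integral => A mA _.
by rewrite nuE// -measure_combE.
Qed.

(** The nonnegative case applies to the positive and negative parts; integrability against each
    [mu i] makes every term finite, so the two sums may be subtracted term by term. *)
Lemma Rintegral_comb (f : T -> R) : measurable_fun setT f ->
  (forall i, P i -> (mu i).-integrable setT (EFin \o f)) ->
  \int[nu]_x f x = \sum_(i | P i) (c i)%:num * \int[mu i]_x f x.
Proof.
move=> mf intf; have mEf : measurable_fun setT (EFin \o f) by exact/measurable_EFinP.
have mp := measurable_funepos mEf; have mn := measurable_funeneg mEf.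
have fE (m : meas) : (\int[m]_x (f x)%:E =
    \int[m]_x (EFin \o f)^\+ x - \int[m]_x (EFin \o f)^\- x)%E.
  by rewrite integralE.
rewrite /Rintegral fE !ge0_integral_comb//.
have -> : (\sum_(i | P i) (c i)%:num%:E * \int[mu i]_x (EFin \o f)^\+ x =
    (\sum_(i | P i) (c i)%:num * fine (\int[mu i]_x (EFin \o f)^\+ x))%:E)%E.
  rewrite -sumEFin; apply: eq_bigr => i Pi.
  rewrite EFinM fineK//.
  apply (integrable_pos_fin_num measurableT (intf i Pi)).
have -> : (\sum_(i | P i) (c i)%:num%:E * \int[mu i]_x (EFin \o f)^\- x =
    (\sum_(i | P i) (c i)%:num * fine (\int[mu i]_x (EFin \o f)^\- x))%:E)%E.
  rewrite -sumEFin; apply: eq_bigr => i Pi.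
  rewrite EFinM fineK//.
  apply (integrable_neg_fin_num measurableT (intf i Pi)).
rewrite -EFinB/= -sumrB; apply: eq_bigr => i Pi.
rewrite -mulrBr fE; congr (_ * _); symmetry; apply: fineB.
- apply (integrable_pos_fin_num measurableT (intf i Pi)).
- apply (integrable_neg_fin_num measurableT (intf i Pi)).
Qed.

End integrable.

End MeasureCombination.

Section ProbabilityOf.
Context d (T : measurableType d) (R : realType).
Variables (mu : {measure set T -> \bar R}) (mu1 : mu setT = 1%E).

(** The proof of mass one is an argument so that a probability structure can be attached to [mu];
    this turns an explicit transport plan into an element of [coupling]. *)
Definition prob_of (_ : mu setT = 1%E) : set T -> \bar R := mu.
HB.instance Definition _ := Measure.on (prob_of mu1).
HB.instance Definition _ := Measure_isProbability.Build _ _ _ (prob_of mu1) mu1.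

End ProbabilityOf.

Section SquaredNorm.
Context {R : realType} {n : nat}.
Implicit Types (x v : 'rV[R]_n).

Definition sqnorm x : R := l2norm x ^+ 2.

Lemma sqnorm_ge0 x : 0 <= sqnorm x. Proof. exact: sqr_ge0. Qed.

Lemma sqnormZ (c : R) x : sqnorm (c *: x) = c ^+ 2 * sqnorm x.
Proof.
rewrite /sqnorm !sql2normE mulr_sumr; apply: eq_bigr => l _.
by rewrite mxE exprMn.
Qed.

Lemma sqnormD x v : sqnorm (x + v) <= 2 * sqnorm x + 2 * sqnorm v.
Proof.
rewrite /sqnorm !sql2normE !mulr_sumr -big_split/=.
apply: ler_sum => l _; rewrite mxE.
by have := sqr_ge0 (x 0 l - v 0 l); nra.
Qed.

(** The bound is free of [t], hence can dominate at the intermediate points of the mean value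
    theorems, about which only [0 <= t <= 1] is known. *)
Lemma sqnorm_line x v (t : R) : 0 <= t <= 1 ->
  sqnorm (x + t *: v) <= 2 * sqnorm x + 2 * sqnorm v.
Proof.
move=> /andP[t0 t1]; apply: (le_trans (sqnormD _ _)); rewrite sqnormZ.
rewrite lerD2l ler_pM2l// ler_piMl ?sqnorm_ge0// expr_le1//.
Qed.

Lemma coord_le_l2norm (m' n' : nat) (A : 'M[R]_(m', n')) k l :
  `|A k l| <= l2norm A.
Proof.
rewrite /l2norm -sqrtr_sqr ler_sqrt; last first.
  by apply: sumr_ge0 => i _; apply: sumr_ge0 => j _; exact: sqr_ge0.
rewrite (bigD1 k)//= (bigD1 l)//= -addrA lerDl addr_ge0//.
  by apply: sumr_ge0 => j _; exact: sqr_ge0.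
by apply: sumr_ge0 => i _; apply: sumr_ge0 => j _; exact: sqr_ge0.
Qed.

End SquaredNorm.

(** * Integrals of functions of quadratic growth *)

Section QuadraticGrowth.
Context {R : realType} {n : nat}.
Let T := 'rV[R]_n.
Implicit Types (m : P2 R n) (f : T -> R) (C : R).

Lemma integrable_quadratic m C :
  m.-integrable setT (EFin \o (fun x : T => C * (1 + sqnorm x))).
Proof.
have -> : EFin \o (fun x : T => C * (1 + sqnorm x)) =
    (fun x => C%:E * (cst 1 x + (sqnorm x)%:E))%E.
  by apply/funext => x; rewrite /= EFinM EFinD.
apply: integrableZl => //; apply: integrableD => //.
  exact: finite_measure_integrable_cst.
apply/integrableP; split; first exact: measurable_Esql2norm.
apply: le_lt_trans (P2_moment2 m); rewrite /moment2 le_eqVlt; apply/orP; left.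
by apply/eqP; apply: eq_integral => x _; rewrite /= ger0_norm// sqnorm_ge0.
Qed.

Lemma integrable_growth m f C : measurable_fun setT f ->
  (forall x, `|f x| <= C * (1 + sqnorm x)) -> m.-integrable setT (EFin \o f).
Proof.
move=> mf fC; apply: (le_integrable _ _ _ (integrable_quadratic m C)) => //.
  exact/measurable_EFinP.
by move=> x _; rewrite /= lee_fin (le_trans (fC x))// ler_norm.
Qed.

Lemma normr_Rintegral_growth m f C : measurable_fun setT f ->
  (forall x, `|f x| <= C * (1 + sqnorm x)) ->
  `|\int[m]_x f x| <= C * (1 + \int[m]_x sqnorm x).
Proof.
move=> mf fC; have intf := integrable_growth m mf fC.
apply: (le_trans (le_normr_Rintegral _ intf)) => //.
have int2 : m.-integrable setT (EFin \o (fun x : T => sqnorm x)).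
  apply: (@integrable_growth _ _ 1); first exact: measurable_sql2norm.
  by move=> x; rewrite mul1r ger0_norm ?sqnorm_ge0// lerDr.
have int1 : m.-integrable setT (EFin \o (fun x : T => 1 : R)).
  exact: finite_measure_integrable_cst.
(* The constant [1] is rewritten as the total mass of [m], which makes the whole bound an
   integral. *)
rewrite -[X in X + _](mulr1 1) -[X in 1 * X]/(fine 1%E) -(@probability_setT _ _ _ m).
rewrite -Rintegral_cst// -RintegralD// -RintegralZl//; last first.
  rewrite (_ : (fun x => 1 + _) = fun x => 1 * (1 + sqnorm x)).
    exact: integrable_quadratic.
  by apply/funext => x; rewrite mul1r.
apply: le_Rintegral => //; last exact: integrable_quadratic.
exact: integrable_norm intf.
Qed.

(** One quadratic function dominates all the [f_ k] and is [m]-integrable by the finite second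
    moment; measurability and the bound pass to the pointwise limit. *)
Lemma P2_dominated_cvg m (f_ : (T -> R)^nat) f C :
  (forall k, measurable_fun setT (f_ k)) ->
  (forall k x, `|f_ k x| <= C * (1 + sqnorm x)) ->
  (forall x, f_ k x @[k --> \oo] --> f x) ->
  [/\ measurable_fun setT f, forall x, `|f x| <= C * (1 + sqnorm x) &
      \int[m]_x f_ k x @[k --> \oo] --> \int[m]_x f x].
Proof.
move=> mf_ f_C f_f.
have mf : measurable_fun setT f by exact: (measurable_fun_cvg mf_).
have fC x : `|f x| <= C * (1 + sqnorm x).
  apply: (ler_cvg_to (cvg_norm (f_f x)) (cvg_cst (C * (1 + sqnorm x)))).
  exact: nearW.
split => //; apply: fine_cvg; rewrite fineK; last first.
  by apply: integrable_fin_num => //; exact: integrable_growth mf fC.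
apply: (@dominated_cvg _ _ _ m setT _ (fun k => EFin \o f_ k) _
  (EFin \o (fun x => C * (1 + sqnorm x)))) => //.
- by move=> k; exact/measurable_EFinP.
- by move=> x _; apply: cvg_EFin; [exact: nearW|exact: f_f].
- exact: integrable_quadratic.
- by move=> k x _; rewrite /= lee_fin.
Qed.

End QuadraticGrowth.

(** * Differentiation along segments of measures *)

Section ProductLimits.
Context {X Y Z : topologicalType}.

Lemma continuous_pairr (f : X * Y -> Z) (a : X) :
  continuous f -> continuous (fun y => f (a, y)).
Proof.
move=> cf y; have ay : (fun y' : Y => (a, y')) @ nbhs y --> (a, y).
  by apply: cvg_pair; [exact: cvg_cst|exact: cvg_id].
exact: (cvg_comp _ _ ay (cf (a, y))).
Qed.

Lemma cvg_continuous_pair (f : X * Y -> Z) (a_ : nat -> X) (y_ : nat -> Y) a y :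
  continuous f -> a_ @ \oo --> a -> y_ @ \oo --> y ->
  f (a_ k, y_ k) @[k --> \oo] --> f (a, y).
Proof.
move=> cf ca cy; have cay : (a_ k, y_ k) @[k --> \oo] --> (a, y).
  exact: cvg_pair.
exact: (cvg_comp _ _ cay (cf (a, y))).
Qed.

End ProductLimits.

Section OneSidedFilters.
Context {R : realType}.

(** Applied with the factors [(1 - h)^-1] and [h^-1], which relate the parameter of a segment to
    that of its two pieces cut at [h]. *)
Lemma at_right0_scale (c : R) : 0 < c -> (fun s => c * s) @ 0^'+ --> (0 : R)^'+.
Proof.
move=> c0 A [e e0 HA]; exists (e / c); first exact: divr_gt0.
move=> s /=; rewrite sub0r normrN => se s0; apply: HA => /=; last exact: mulr_gt0.
by rewrite sub0r normrN normrM gtr0_norm// mulrC -ltr_pdivlMr.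
Qed.

Lemma at_left_reflect (p : R) : (fun x => p - x) @ p^'- --> (0 : R)^'+.
Proof.
move=> A [e e0 HA]; exists e => // x /= xe xp.
apply: HA => /=; last by rewrite subr_gt0.
by rewrite sub0r normrN.
Qed.

Lemma cvg_at_leftB (T : topologicalType) (f : R -> T) (p : R) (l : T) :
  f (p - s) @[s --> 0^'+] --> l -> f x @[x --> p^'-] --> l.
Proof.
move=> /(cvg_comp _ _ (@at_left_reflect p)).
rewrite (_ : _ \o _ = f)//.
by apply/funext => x /=; rewrite subKr.
Qed.

End OneSidedFilters.

Section SegmentTheory.
Context {R : realType} {n : nat}.
Let T := 'rV[R]_n.
Implicit Types (m : P2 R n) (h t : R).

Lemma segment0 m m' : segment m m' 0 = m.
Proof.
apply: P2_ext => A mA; rewrite segmentE ?lexx ?ler01//.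
by rewrite subr0 mul1e mul0e adde0.
Qed.

Lemma segment1 m m' : segment m m' 1 = m'.
Proof.
apply: P2_ext => A mA; rewrite segmentE ?lexx ?ler01//.
by rewrite subrr mul1e mul0e add0e.
Qed.

Lemma P2_fin_num m (A : set T) : measurable A -> (m A \is a fin_num)%E.
Proof. exact: fin_num_measure. Qed.

(** A segment from a point of a segment to one of its ends is a piece of that segment. With
    [segment_segmentl], this turns the one-sided derivative at [0] in [is_linear_derivative] into
    right and left derivatives at any parameter. *)
Lemma segment_segmentr m m' h t : 0 <= h <= 1 -> 0 <= t <= 1 ->
  segment (segment m m' h) m' t = segment m m' (h + t * (1 - h)).
Proof.
move=> h01 t01; apply: P2_ext => A mA; rewrite !segmentE//; last first.
  by move: h01 t01 => /andP[h0 h1] /andP[t0 t1]; apply/andP; split; nra.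
rewrite -(fineK (P2_fin_num m mA)) -(fineK (P2_fin_num m' mA)).
by rewrite -!(EFinM, EFinD); congr EFin; ring.
Qed.

Lemma segment_segmentl m m' h t : 0 <= h <= 1 -> 0 <= t <= 1 ->
  segment (segment m m' h) m t = segment m m' (h - t * h).
Proof.
move=> h01 t01; apply: P2_ext => A mA; rewrite !segmentE//; last first.
  by move: h01 t01 => /andP[h0 h1] /andP[t0 t1]; apply/andP; split; nra.
rewrite -(fineK (P2_fin_num m mA)) -(fineK (P2_fin_num m' mA)).
by rewrite -!(EFinM, EFinD); congr EFin; ring.
Qed.

Lemma Rintegral_segment m m' h (f : T -> R) : 0 <= h <= 1 ->
  measurable_fun setT f -> m.-integrable setT (EFin \o f) ->
  m'.-integrable setT (EFin \o f) ->
  \int[segment m m' h]_x f x = (1 - h) * \int[m]_x f x + h * \int[m']_x f x.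
Proof.
move=> h01 mf im im'.
pose c (b : bool) : {nonneg R} :=
  if b then NngNum (clip01_ge0 h) else NngNum (onem_clip01_ge0 h).
pose mu (b : bool) : {measure set T -> \bar R} := if b then m' else m.
have hE : clip01 h = h.
  by move: h01 => /andP[h0 h1]; rewrite /clip01 (min_idPr h1) (max_idPr h0).
rewrite (@Rintegral_comb _ _ _ _ _ xpredT c mu)//.
- by rewrite big_bool /= hE addrC.
- move=> A mA; apply: (etrans (segmentE m m' h01 mA)).
  by rewrite big_bool /= hE addeC.
- by case.
Qed.

Section derivative.
Variables (V : P2 R n -> R) (d : P2 R n -> T -> R).
Hypothesis dV : is_linear_derivative V d.

Lemma linear_derivative_continuous m : continuous (d m).
Proof.
by case: dV => cd _ _; exact: (@continuous_pairr (P2 R n) T R _ m cd).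
Qed.

Lemma linear_derivative_measurable m : measurable_fun setT (d m).
Proof.
by apply: continuous_measurable_real; exact: linear_derivative_continuous.
Qed.

Lemma linear_derivative_integrable m m' :
  m'.-integrable setT (EFin \o d m).
Proof. by case: dV. Qed.

Variables (m m' : P2 R n).

Definition segment_slope h : R :=
  \int[m']_x d (segment m m' h) x - \int[m]_x d (segment m m' h) x.

Let g h := V (segment m m' h).

(** With [m_h] the point of parameter [h], [m' - m_h = (1 - h) (m' - m)]: the step [s] from [h] is
    the step [s / (1 - h)] on the segment from [m_h] to [m'], and both sides carry the same
    factor. *)
Let cvg_right h : 0 <= h < 1 ->
  (g (h + s) - g h) / s @[s --> 0^'+] --> segment_slope h.
Proof.
move=> /andP[h0 h1]; have h1' : 0 < 1 - h by rewrite subr_gt0.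
have h01 : 0 <= h <= 1 by rewrite h0 ltW.
case: (dV) => _ _ /(_ (segment m m' h) m') Vm.
have := cvg_comp _ _ (@at_right0_scale R (1 - h)^-1 _) Vm.
rewrite invr_gt0 h1' => /(_ isT).
move=> /(cvgMr (a := (1 - h)^-1)).
rewrite Rintegral_segment//; [|exact: linear_derivative_measurable
  |exact: linear_derivative_integrable|exact: linear_derivative_integrable].
have -> : segment_slope h = (1 - h)^-1 * (\int[m']_x d (segment m m' h) x -
    ((1 - h) * \int[m]_x d (segment m m' h) x +
     h * \int[m']_x d (segment m m' h) x)).
  by rewrite /segment_slope; field; exact: lt0r_neq0.
apply: cvg_trans; apply: near_eq_cvg; near=> s => /=.
have s0 : 0 < s by near: s; exact: nbhs_right_gt.
(* The rescaled parameter must stay in [[0, 1]], outside which [segment] is clipped. *)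
have sh : s <= 1 - h by near: s; exact: nbhs_right_le.
rewrite segment_segmentr//; last first.
  apply/andP; split; last by rewrite ler_pdivrMl// mulr1.
  by rewrite mulr_ge0// ?invr_ge0 ltW.
rewrite mulrAC mulVf ?lt0r_neq0// mul1r /g; field.
by rewrite !lt0r_neq0.
Unshelve. all: by end_near. Qed.

(** Going back towards [m] the direction is [m - m_h = - h (m' - m)]; the sign is absorbed by the
    divisor [- s]. *)
Let cvg_left h : 0 < h <= 1 ->
  (g (h - s) - g h) / - s @[s --> 0^'+] --> segment_slope h.
Proof.
move=> /andP[h0 h1].
have h01 : 0 <= h <= 1 by rewrite h1 ltW.
case: (dV) => _ _ /(_ (segment m m' h) m) Vm.
have := cvg_comp _ _ (@at_right0_scale R h^-1 _) Vm.
rewrite invr_gt0 h0 => /(_ isT).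
move=> /(cvgMr (a := - h^-1)).
rewrite Rintegral_segment//; [|exact: linear_derivative_measurable
  |exact: linear_derivative_integrable|exact: linear_derivative_integrable].
have -> : segment_slope h = - h^-1 * (\int[m]_x d (segment m m' h) x -
    ((1 - h) * \int[m]_x d (segment m m' h) x +
     h * \int[m']_x d (segment m m' h) x)).
  by rewrite /segment_slope; field; exact: lt0r_neq0.
apply: cvg_trans; apply: near_eq_cvg; near=> s => /=.
have s0 : 0 < s by near: s; exact: nbhs_right_gt.
have sh : s <= h by near: s; exact: nbhs_right_le.
rewrite segment_segmentl//; last first.
  apply/andP; split; last by rewrite ler_pdivrMl// mulr1.
  by rewrite mulr_ge0// ?invr_ge0 ltW.
rewrite mulrAC mulVf ?lt0r_neq0// mul1r /g; field.
by rewrite !lt0r_neq0.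
Unshelve. all: by end_near. Qed.

Lemma is_derive_segment h : 0 < h < 1 ->
  is_derive h 1 (fun t => V (segment m m' t)) (segment_slope h).
Proof.
move=> /andP[h0 h1].
suff H : (fun s : R => s^-1 *: (((fun t => V (segment m m' t)) \o shift h)
    (s *: (1 : R)) - V (segment m m' h))) @ 0^' --> segment_slope h.
  by split; [apply/cvg_ex; exists (segment_slope h)|exact: cvg_lim H].
apply: (@cvg_at_right_left_dnbhs _ R^o).
- have /cvg_right : 0 <= h < 1 by rewrite h1 ltW.
  apply: cvg_trans; apply: near_eq_cvg; apply: nearW => s /=.
  by rewrite /g /GRing.scale/= mulr1 mulrC [s + h]addrC.
- apply: cvg_at_leftB.
  have /cvg_left : 0 < h <= 1 by rewrite h0 ltW.
  apply: cvg_trans; apply: near_eq_cvg; apply: nearW => s /=.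
  by rewrite /g /GRing.scale/= sub0r mulr1 mulrC [- s + h]addrC.
Qed.

(** Inside, derivability gives continuity. At an end point, the one-sided difference quotient
    converges, and multiplying it by its vanishing step gives the one-sided limit of the
    function. *)
Lemma continuous_segment :
  {within `[0, 1], continuous (fun t => V (segment m m' t))}.
Proof.
apply/continuous_within_itvP; first exact: ltr01.
split.
- move=> h; rewrite in_itv/= => h01; apply: differentiable_continuous.
  by apply/derivable1_diffP; have [] := is_derive_segment h01.
- have h01 : 0 <= (0 : R) < 1 by rewrite lexx ltr01.
  have cr := cvg_right h01.
  have : g 0 + s * ((g (0 + s) - g 0) / s) @[s --> 0^'+] --> g 0 + 0 * segment_slope 0.
    apply: cvgD; first exact: cvg_cst.
    by apply: cvgM cr; exact: cvg_within.
  rewrite mul0r addr0; apply: cvg_trans; apply: near_eq_cvg; near=> s => /=.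
  have s0 : 0 < s by near: s; exact: nbhs_right_gt.
  by rewrite add0r mulrC divfK ?lt0r_neq0// subrKC.
- apply: cvg_at_leftB.
  have h01 : 0 < (1 : R) <= 1 by rewrite lexx ltr01.
  have cl := cvg_left h01.
  have : g 1 - s * ((g (1 - s) - g 1) / - s) @[s --> 0^'+] --> g 1 - 0 * segment_slope 1.
    apply: cvgB; first exact: cvg_cst.
    by apply: cvgM cl; exact: cvg_within.
  rewrite mul0r subr0; apply: cvg_trans; apply: near_eq_cvg; near=> s => /=.
  have s0 : 0 < s by near: s; exact: nbhs_right_gt.
  rewrite -/(g _) -/(g _); field; exact: lt0r_neq0.
Unshelve. all: by end_near. Qed.

Lemma segment_MVT h : 0 < h <= 1 -> exists2 t, 0 < t < h &
  V (segment m m' h) - V m = h * segment_slope t.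
Proof.
move=> /andP[h0 h1].
have [t th||t] := @MVT R (fun t => V (segment m m' t)) segment_slope 0 h h0.
- apply: is_derive_segment; move: th; rewrite in_itv/= => /andP[-> th].
  exact: lt_le_trans th h1.
- apply: continuous_subspaceW continuous_segment.
  by apply: subset_itvl; rewrite bnd_simp.
by rewrite in_itv/= => th; rewrite segment0 subr0 mulrC => E; exists t.
Qed.

(** The remainder stays an increment of slopes because [classC2] provides linear derivatives in [m]
    for the components of [Dm u], not for [linear_derivative u] itself. *)
Lemma segment_second_order : exists2 t, 0 < t < 1 &
  V m' - V m - segment_slope 0 = (segment_slope t - segment_slope 0) / (2 * t).
Proof.
have [t||t] := @second_order_MVT R (fun t => V (segment m m' t)) segment_slope
  1 (segment_slope 0) ltr01.
- by rewrite in_itv/=; exact: is_derive_segment.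
- exact: continuous_segment.
rewrite in_itv/= segment0 segment1 mul1r expr1n mul1r => t01 E.
by exists t.
Qed.

End derivative.

End SegmentTheory.

(** * Mixtures of translates and their Wasserstein convergence *)

Section Mixtures.
Context {R : realType} {n : nat} {I : finType}.
Let T := 'rV[R]_n.
Implicit Types (mu m : P2 R n) (P : pred I) (w : I -> {nonneg R}) (v : I -> T).

(* [mu] is the law of [X + V], where [X] has law [m] and [V] is independent of
   [X] and equal to [v i] with probability [w i]. *)
Definition mixture P w v m mu : Prop := forall A : set T, measurable A ->
  mu A = (\sum_(i | P i) (w i)%:num%:E * mshift m (v i) A)%E.

(** The translate of [m] by [y] is itself an element of [P2], so [intf] applies to it, and a change
    of variables returns to [m]. *)
Lemma integrable_shift m (f : T -> R) (y : T) : measurable_fun setT f ->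
  (forall m', m'.-integrable setT (EFin \o f)) ->
  m.-integrable setT (EFin \o (fun x => f (x + y))).
Proof.
move=> mf intf.
have my : mshift m y setT = 1%E.
  by rewrite /mshift /pushforward preimage_setT; exact: probability_setT.
have m2 : (moment2 (mshift m y) < +oo)%E.
  apply: moment2_shift; last exact: P2_moment2.
  by rewrite -ge0_fin_numE//; exact: fin_num_measure.
have /integrableP[_ ify] := intf (P2_of my m2).
apply/integrableP; split.
  apply/measurable_EFinP; apply: (measurableT_comp (f := f)) => //.
  exact: measurable_shift.
move: ify; rewrite (eq_measure_integral (mshift m y)); last first.
  by move=> A mA _; exact: P2_ofE.
rewrite ge0_integral_pushforward//; first exact: measurable_shift.
by apply: measurableT_comp => //; exact/measurable_EFinP.
Qed.

Section integral.
Variables (P : pred I) (w : I -> {nonneg R}) (v : I -> T) (m mu : P2 R n).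
Hypothesis mmu : mixture P w v m mu.
Variable f : T -> R.
Hypotheses (mf : measurable_fun setT f)
  (intf : forall m', m'.-integrable setT (EFin \o f)).

Lemma Rintegral_mixture :
  \int[mu]_x f x = \sum_(i | P i) (w i)%:num * \int[m]_x f (x + v i).
Proof.
rewrite (@Rintegral_comb _ _ _ _ _ P w (fun i => mshift m (v i)))//.
- apply: eq_bigr => i _; congr (_ * fine _).
  rewrite integral_pushforward//; first exact: measurable_shift.
    exact/measurable_EFinP.
  exact: integrable_shift.
- move=> i _; apply: integrable_pushforward => //; first exact: measurable_shift.
    exact/measurable_EFinP.
  exact: integrable_shift.
Qed.

(** Since the weights sum to one, the integral against [m] can be spread over the translates; this
    exposes increments of [f], on which mean value theorems act. *)
Lemma Rintegral_mixtureB : \sum_(i | P i) (w i)%:num = 1 ->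
  \int[mu]_x f x - \int[m]_x f x =
  \sum_(i | P i) (w i)%:num * \int[m]_x (f (x + v i) - f x).
Proof.
move=> w1; rewrite Rintegral_mixture -[X in _ - X]mul1r -w1 mulr_suml -sumrB.
apply: eq_bigr => i _; rewrite -mulrBr RintegralB//.
  exact: integrable_shift.
exact: intf.
Qed.

End integral.

End Mixtures.

(** * Wasserstein convergence of mixtures with vanishing translations *)

Section WassersteinConvergence.
Context {R : realType} {n : nat}.
Let T := 'rV[R]_n.
Implicit Types (m : P2 R n).

(** By [W2_open], an open set contains a [W2] ball around each of its points, so eventual membership
    in every ball around [m] suffices. *)
Lemma cvg_W2 (m_ : (P2 R n)^nat) m :
  (forall e : R, 0 < e -> \forall k \near \oo, (W2 m (m_ k) < e%:E)%E) ->
  m_ @ \oo --> m.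
Proof.
move=> H A; rewrite nbhsE => -[B [oB Bm] BA].
have [e e0 eB] := oB m Bm.
by apply: filterS (H e e0) => k /eB /BA.
Qed.

Lemma measurable_graph (y : T) : measurable_fun setT (fun x : T => (x, x + y)).
Proof. by apply: measurable_fun_pair => //; exact: measurable_shift. Qed.

(** The law of [(X, X + y)] for [X] of law [m]: the coupling of [m] with its translate. *)
Definition graph_meas m (y : T) := pushforward m (fun x : T => (x, x + y)).
HB.instance Definition _ m y := Measure.copy (graph_meas m y)
  (measure_function_pushforward__canonical__measure_function_Measure
    m (measurable_graph y)).

Lemma measurable_sqdist :
  measurable_fun setT (fun z : T * T => (l2norm (z.1 - z.2) ^+ 2)%:E).
Proof.
apply/measurable_EFinP; under eq_fun do rewrite sql2normE.
apply: measurable_sum => l; apply: measurable_funX.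
under eq_fun do rewrite !mxE.
apply: measurable_funB.
  apply: (measurableT_comp (f := fun x : T => x 0 l)); last exact: measurable_fst.
  by apply: continuous_measurable_real => x; exact: coord_continuous.
apply: (measurableT_comp (f := fun x : T => x 0 l)); last exact: measurable_snd.
by apply: continuous_measurable_real => x; exact: coord_continuous.
Qed.

Lemma integral_sqdist_graph m (y : T) :
  (\int[graph_meas m y]_z (l2norm (z.1 - z.2) ^+ 2)%:E = (sqnorm y)%:E)%E.
Proof.
rewrite ge0_integral_pushforward//=; last 3 first.
- exact: measurable_graph.
- exact: measurable_sqdist.
- by move=> z _; rewrite lee_fin sqr_ge0.
rewrite preimage_setT.
transitivity (\int[m]_x (sqnorm y)%:E)%E.
  apply: eq_integral => x _; rewrite /= opprD addrA subrr add0r.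
  by rewrite /sqnorm !sql2normE; under eq_bigr do rewrite mxE sqrrN.
rewrite integral_cst// -[RHS]mule1; congr (_ * _)%E.
exact: probability_setT.
Qed.

(** An explicit coupling has cost [h] times the mean of the [sqnorm (v i)]; dropping the factor
    [h <= 1] makes the bound uniform along the segment. *)
Lemma W2_segment_mixture (I : finType) (P : pred I) w v m mu (h : R) :
  mixture P w v m mu -> \sum_(i : I | P i) (w i)%:num = 1 -> 0 <= h <= 1 ->
  (W2 m (segment m mu h) <=
    (Num.sqrt (\sum_(i | P i) (w i)%:num * sqnorm (v i)))%:E)%E.
Proof.
move=> mmu w1 h01.
have hE : clip01 h = h.
  by move: h01 => /andP[h0 h1]; rewrite /clip01 (min_idPr h1) (max_idPr h0).
pose nu := measure_comb P w (fun i => graph_meas m (v i)).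
pose c (b : bool) : {nonneg R} :=
  if b then NngNum (clip01_ge0 h) else NngNum (onem_clip01_ge0 h).
(* With weight [h] the point [x] is sent to [x + v i] with probability [w i], with weight [1 - h] it
   stays in place; the second marginal is then the segment. *)
pose pi := measure_comb xpredT c (fun b : bool =>
  if b then nu else graph_meas m 0).
have pi_fst A : pi (A `*` setT) = m A.
  rewrite measure_combE big_bool/= hE measure_combE /=.
  rewrite (eq_bigr (fun i => (w i)%:num%:E * m A)%E); last first.
    move=> i _; congr (_ * m _)%E; apply/seteqP.
    by split => [x []|x]//=.
  rewrite -ge0_sume_distrl; last by move=> i _; rewrite lee_fin.
  rewrite sumEFin w1 mul1e /graph_meas /pushforward.
  rewrite (_ : _ @^-1` _ = A); last by apply/seteqP; split => [x []|x]//=.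
  rewrite -ge0_muleDl ?lee_fin//.
    by rewrite -EFinD addrC subrK mul1e.
  - by case/andP : h01.
  - by rewrite subr_ge0; case/andP : h01.
have pi_snd A : measurable A -> pi (setT `*` A) = segment m mu h A.
  move=> mA; rewrite measure_combE big_bool/= hE measure_combE segmentE//.
  rewrite addeC; congr (_ * _ + _ * _)%E.
    rewrite /= /graph_meas /pushforward; congr (m _); apply/seteqP.
    by split => [x []|x]//=; rewrite addr0.
  rewrite mmu//; apply: eq_bigr => i _; congr (_ * m _)%E; apply/seteqP.
  by split => [x []|x]//=.
have pi1 : pi setT = 1%E by rewrite -setXTT pi_fst; exact: probability_setT.
apply: (@le_trans _ _
  ((\int[prob_of pi1]_z (l2norm (z.1 - z.2) ^+ 2)%:E) `^ 2^-1)%E).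
  apply: ereal_inf_lbound; exists (prob_of pi1 : probability _ _) => //.
  by move=> A mA; split; [exact: pi_fst|exact: pi_snd].
have sqdist_ge0 (z : T * T) : (0 <= (l2norm (z.1 - z.2) ^+ 2)%:E)%E.
  by rewrite lee_fin sqr_ge0.
have sqnorm0 : sqnorm (0 : T) = 0.
  by rewrite -[X in sqnorm X](scale0r 0) sqnormZ expr0n/= mul0r.
have nuE : (\int[nu]_z (l2norm (z.1 - z.2) ^+ 2)%:E =
    (\sum_(i | P i) (w i)%:num * sqnorm (v i))%:E)%E.
  rewrite ge0_integral_measure_comb//; last exact: measurable_sqdist.
  rewrite -sumEFin; apply: eq_bigr => i _.
  by rewrite EFinM -(integral_sqdist_graph m).
have piE : (\int[prob_of pi1]_z (l2norm (z.1 - z.2) ^+ 2)%:E =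
    (h * \sum_(i | P i) (w i)%:num * sqnorm (v i))%:E)%E.
  rewrite ge0_integral_measure_comb//; last exact: measurable_sqdist.
  rewrite (eq_bigr (fun b : bool => if b then
      (clip01 h)%:E * \int[nu]_z (l2norm (z.1 - z.2) ^+ 2)%:E else
      (1 - clip01 h)%:E *
        \int[graph_meas m 0%R]_z (l2norm (z.1 - z.2) ^+ 2)%:E)%E); last by case.
  rewrite big_bool nuE integral_sqdist_graph hE.
  rewrite sqnorm0 mule0 [LHS]adde0.
  by rewrite -EFinM.
rewrite piE poweR_EFin powR12_sqrt.
  rewrite lee_fin; apply: ler_wsqrtr.
  apply: ler_piMl; last by case/andP : h01.
  by apply: sumr_ge0 => i _; rewrite mulr_ge0// sqnorm_ge0.
move: h01 => /andP[h0 h1].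
rewrite mulr_ge0//.
by apply: sumr_ge0 => i _; rewrite mulr_ge0// sqnorm_ge0.
Qed.

(** The bound on [W2] is proportional to [|e_ k|] and free of [h_], so the parameters may be those
    supplied by a mean value theorem, chosen separately for each [k]. *)
Lemma cvg_segment_mixture (I : finType) (P : pred I) w v m
    (mu_ : (P2 R n)^nat) (e_ h_ : R^nat) :
  (forall k, mixture P w (fun i => e_ k *: v i) m (mu_ k)) ->
  \sum_(i : I | P i) (w i)%:num = 1 -> (forall k, 0 <= h_ k <= 1) ->
  e_ @ \oo --> 0 -> (fun k => segment m (mu_ k) (h_ k)) @ \oo --> m.
Proof.
move=> mmu w1 h01 e0; apply: cvg_W2 => e egt0.
pose S := \sum_(i | P i) (w i)%:num * sqnorm (v i).
have ne0 : (fun k => `|e_ k|) @ \oo --> `|0 : R| by exact: cvg_norm.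
have : (fun k => `|e_ k| * Num.sqrt S) @ \oo --> `|0 : R| * Num.sqrt S.
  by apply: cvgM => //; exact: cvg_cst.
rewrite normr0 mul0r => /cvgr_lt /(_ e egt0).
apply: filterS => k ke; apply: le_lt_trans (W2_segment_mixture (mmu k) w1 (h01 k)) _.
rewrite lte_fin; apply: le_lt_trans ke; rewrite le_eqVlt; apply/orP; left.
rewrite -sqrtr_sqr -sqrtrM ?sqr_ge0// /S mulr_sumr; apply/eqP; congr Num.sqrt.
by apply: eq_bigr => i _; rewrite sqnormZ mulrCA.
Qed.

End WassersteinConvergence.

Section MixtureOfDilations.
Context {R : realType} {n : nat} {I : finType}.
Implicit Types (P : pred I) (w : I -> {nonneg R}) (v : I -> 'rV[R]_n).

(** This is [s^-1 (s x + v) = x + s^-1 v], read on preimages: dilating, translating and dilating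
    back is a translation by [s^-1 *: v]. *)
Lemma dilated_mixture P w v (m mu : P2 R n) (s : R) : s != 0 ->
  (forall A : set 'rV[R]_n, measurable A -> mu A =
    mdilate (mbigadd P (fun j => mshift (mscale (w j) (mdilate m s)) (v j)))
      s^-1 A) ->
  mixture P w (fun i => s^-1 *: v i) m mu.
Proof.
move=> s0 muE A mA; rewrite muE// {1}/mdilate /pushforward mbigaddE.
apply: eq_bigr => i _; rewrite /= /mshift /pushforward /mscale /= /mdilate.
rewrite /pushforward; congr (_ * m _)%E; apply/seteqP.
by split => x /=; rewrite scalerDr scalerA mulVf// scale1r.
Qed.

End MixtureOfDilations.

(** * Second order expansion along a mixture *)

Section SequentialContinuity.
Context {R : realType} {n : nat}.

(** Dominated convergence is available along sequences only. If the limit failed, points in the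
    balls of radius [1 / (k + 1)] with values at distance at least [e] would form a sequence
    contradicting [H]. *)
Lemma seq_continuous (f : 'rV[R]_n -> R) (x : 'rV[R]_n) :
  (forall y_ : nat -> 'rV[R]_n, y_ @ \oo --> nbhs x -> f (y_ k) @[k --> \oo] --> f x) ->
  f y @[y --> nbhs x] --> f x.
Proof.
move=> H; apply: contrapT => nf.
have [e e0 He] : exists2 e : R, 0 < e &
    forall k : nat, exists y, ball x k.+1%:R^-1 y /\ e <= `|f x - f y|.
  apply: contrapT => nH; apply: nf; apply/cvgrPdist_lt => e e0.
  have [k Hk] : exists k : nat, forall y, ball x k.+1%:R^-1 y -> `|f x - f y| < e.
    apply: contrapT => nk; apply: nH; exists e => // k.
    apply: contrapT => ny; apply: nk; exists k => y xy.
    by rewrite ltNge; apply/negP => ey; apply: ny; exists y.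
  apply/nbhs_ballP; exists k.+1%:R^-1 => //=.
have [y_ Hy] := choice He.
have yx : y_ @ \oo --> nbhs x.
  move=> A /nbhs_ballP[r /= r0 rA].
  suff : \forall k \near \oo, A (y_ k) by [].
  near=> k; apply: rA.
  have kr : k.+1%:R^-1 <= r.
    by apply: ltW; near: k; exact: near_infty_natSinv_lt (PosNum r0).
  exact: (le_ball kr (Hy k).1).
have /cvgrPdist_lt /(_ e e0)[k _ /(_ k (leqnn k))] := H _ yx.
by rewrite ltNge (Hy k).2.
Unshelve. all: by end_near. Qed.

End SequentialContinuity.

(** * Finite sums, linear and bilinear forms under integrals and limits *)

Section FiniteSums.
Context {R : realType} {n : nat}.
Implicit Types (m : P2 R n).

Lemma integrable_sumr (I : Type) (r : seq I) (P : pred I) m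
    (f : I -> 'rV[R]_n -> R) :
  (forall i, P i -> m.-integrable setT (EFin \o f i)) ->
  m.-integrable setT (EFin \o (fun x => \sum_(i <- r | P i) f i x)).
Proof.
move=> intf.
rewrite (_ : EFin \o _ = fun x => (\sum_(j <- r | P j) (f j x)%:E)%E).
  by apply: integrable_sum => // j Pj; exact: intf.
by apply/funext => x /=; rewrite sumEFin.
Qed.

Lemma Rintegral_sum (I : Type) (r : seq I) (P : pred I) m (f : I -> 'rV[R]_n -> R) :
  (forall i, P i -> m.-integrable setT (EFin \o f i)) ->
  \int[m]_x (\sum_(i <- r | P i) f i x) = \sum_(i <- r | P i) \int[m]_x f i x.
Proof.
move=> intf; elim: r => [|i r IH].
  under eq_Rintegral do rewrite big_nil.
  by rewrite Rintegral_cst// mul0r big_nil.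
rewrite big_cons; case: ifPn => Pi; last first.
  by rewrite -IH; apply: eq_Rintegral => x _; rewrite big_cons (negbTE Pi).
under eq_Rintegral do rewrite big_cons Pi.
rewrite RintegralD ?IH//; first exact: intf.
exact: integrable_sumr.
Qed.

End FiniteSums.

Section LinearBounds.
Context {R : realType} {n : nat}.
Implicit Types (v w : 'rV[R]_n).

Definition norm1 v : R := \sum_a `|v 0 a|.

Lemma norm1_ge0 v : 0 <= norm1 v. Proof. exact: sumr_ge0. Qed.

Lemma normr_dot v w (c : R) : (forall a, `|w 0 a| <= c) ->
  `|dot v w| <= norm1 v * c.
Proof.
move=> wc; rewrite dotE mulr_suml; apply: le_trans (ler_norm_sum _ _ _) _.
by apply: ler_sum => a _; rewrite normrM ler_wpM2l.
Qed.

Lemma normr_bilin v (M : 'M[R]_n) w :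
  `|bilin v M w| <= norm1 v * norm1 w * l2norm M.
Proof.
rewrite bilinE -mulrA mulr_suml; apply: le_trans (ler_norm_sum _ _ _) _.
apply: ler_sum => a _; rewrite mulr_suml mulr_sumr.
apply: le_trans (ler_norm_sum _ _ _) _; apply: ler_sum => b _.
by rewrite !normrM -mulrA !ler_wpM2l// coord_le_l2norm.
Qed.

End LinearBounds.

Section LinearLimits.
Context {R : realType} {n : nat}.
Implicit Types (m : P2 R n) (v w x : 'rV[R]_n).

Lemma cvg_line x v (t_ : R^nat) : t_ @ \oo --> 0 ->
  (fun k => x + t_ k *: v) @ \oo --> nbhs x.
Proof.
move=> t0; have : (fun k => x + t_ k *: v) @ \oo --> nbhs (x + (0 : R) *: v).
  by apply: cvgD; [exact: cvg_cst|apply: cvgZr_tmp].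
by rewrite scale0r addr0.
Qed.

Lemma cvg_squeeze0 (t_ e_ : R^nat) : (forall k, 0 < t_ k < e_ k) ->
  e_ @ \oo --> 0 -> t_ @ \oo --> 0.
Proof.
move=> te e0; apply: (squeeze_cvgr _ (cvg_cst 0) e0).
by apply: nearW => k; have /andP[/ltW -> /ltW ->] := te k.
Qed.

Lemma cvg_coord (p q : nat) (M_ : nat -> 'M[R]_(p, q)) (M : 'M[R]_(p, q)) i j :
  M_ @ \oo --> nbhs M -> M_ k i j @[k --> \oo] --> M i j.
Proof.
move=> cM; exact: (cvg_comp _ _ cM (@coord_continuous R p q i j M)).
Qed.

Lemma cvg_sumr (I : Type) (r : seq I) (P : pred I) (f : I -> R^nat) (l : I -> R) :
  (forall i, P i -> f i @ \oo --> l i) ->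
  \sum_(i <- r | P i) f i k @[k --> \oo] --> \sum_(i <- r | P i) l i.
Proof.
move=> fl; elim: r => [|i r IH].
  by under eq_cvg do rewrite big_nil; rewrite big_nil; exact: cvg_cst.
under eq_cvg do rewrite big_cons; rewrite big_cons.
by case: ifPn => // Pi; apply: cvgD => //; exact: fl.
Qed.

Lemma cvg_bilin v (M_ : nat -> 'M[R]_n) (M : 'M[R]_n) w :
  (forall a b, M_ k a b @[k --> \oo] --> M a b) ->
  bilin v (M_ k) w @[k --> \oo] --> bilin v M w.
Proof.
move=> cM; under eq_cvg do rewrite bilinE; rewrite bilinE.
apply: cvg_sumr => a _; apply: cvg_sumr => b _.
by apply: cvgM; [exact: cvg_cst|exact: cM].
Qed.

Lemma measurable_dot v (F : 'rV[R]_n -> 'rV[R]_n) :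
  (forall a, measurable_fun setT (fun x => F x 0 a)) ->
  measurable_fun setT (fun x => dot v (F x)).
Proof.
move=> mF; under eq_fun do rewrite dotE.
by apply: measurable_sum => a; apply: measurable_funM.
Qed.

Lemma integrable_cstM m (c : R) (f : 'rV[R]_n -> R) :
  m.-integrable setT (EFin \o f) ->
  m.-integrable setT (EFin \o (fun x => c * f x)).
Proof.
move=> mf; rewrite (_ : _ \o _ = fun x => (c%:E * (f x)%:E)%E).
  exact: integrableZl.
by apply/funext.
Qed.

Lemma integrable_subr m (f g : 'rV[R]_n -> R) :
  m.-integrable setT (EFin \o f) -> m.-integrable setT (EFin \o g) ->
  m.-integrable setT (EFin \o (fun x => f x - g x)).
Proof.
move=> mf mg; rewrite (_ : _ \o _ = fun x => ((f x)%:E - (g x)%:E)%E).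
  exact: integrableB.
by apply/funext.
Qed.

Lemma integrable_dot m v (F : 'rV[R]_n -> 'rV[R]_n) :
  (forall a, m.-integrable setT (EFin \o (fun x => F x 0 a))) ->
  m.-integrable setT (EFin \o (fun x => dot v (F x))).
Proof.
move=> iF; under [X in _ \o X]eq_fun do rewrite dotE.
by apply: integrable_sumr => a _; exact: integrable_cstM.
Qed.

Lemma Rintegral_dot m v (F : 'rV[R]_n -> 'rV[R]_n) :
  (forall a, m.-integrable setT (EFin \o (fun x => F x 0 a))) ->
  \int[m]_x dot v (F x) = dot v (\row_a \int[m]_x F x 0 a).
Proof.
move=> iF; under eq_Rintegral do rewrite dotE; rewrite dotE.
rewrite Rintegral_sum; last by move=> a _; exact: integrable_cstM.
by apply: eq_bigr => a _; rewrite RintegralZl// mxE.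
Qed.

Lemma integrable_bilin m v w (F : 'rV[R]_n -> 'M[R]_n) :
  (forall a b, m.-integrable setT (EFin \o (fun x => F x a b))) ->
  m.-integrable setT (EFin \o (fun x => bilin v (F x) w)).
Proof.
move=> iF; under [X in _ \o X]eq_fun do rewrite bilinE.
apply: integrable_sumr => a _; apply: integrable_sumr => b _.
exact: integrable_cstM.
Qed.

Lemma Rintegral_bilin m v w (F : 'rV[R]_n -> 'M[R]_n) :
  (forall a b, m.-integrable setT (EFin \o (fun x => F x a b))) ->
  \int[m]_x bilin v (F x) w = bilin v (\matrix_(a, b) \int[m]_x F x a b) w.
Proof.
move=> iF; under eq_Rintegral do rewrite bilinE; rewrite bilinE.
rewrite Rintegral_sum => [|a _]; last first.
  by apply: integrable_sumr => b _; exact: integrable_cstM.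
apply: eq_bigr => a _; rewrite Rintegral_sum; last first.
  by move=> b _; exact: integrable_cstM.
by apply: eq_bigr => b _; rewrite RintegralZl// mxE.
Qed.

End LinearLimits.

(** * Consequences of class C2, and the term in [Q] *)

Section ClassC2.
Context {R : realType} {n : nat}.
Let T := 'rV[R]_n.
Implicit Types (V : P2 R n -> R) (m mu : P2 R n) (x y z v : T).

Lemma linear_derivativeP V : Frechet_differentiable V ->
  is_linear_derivative V (linear_derivative V).
Proof. by move=> dV; exact: (getPex dV). Qed.

Variables (u : P2 R n -> R) (hu : classC2 u).

(** Its gradient in the new space variable is row [a] of [D2mm], see [gradient_Dm_derivative]. *)
Definition Dm_derivative y a := linear_derivative (fun m => Dm u m y 0 a).

Lemma linear_derivative_u : is_linear_derivative u (linear_derivative u).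
Proof. by case: hu => -[du _ _ _] *; exact: linear_derivativeP. Qed.

Lemma Dm_derivativeP y a :
  is_linear_derivative (fun m => Dm u m y 0 a) (Dm_derivative y a).
Proof. by case: hu => _ [_ dD _] *; apply: linear_derivativeP; exact: dD. Qed.

Lemma differentiable_u m x : differentiable (linear_derivative u m) x.
Proof. by case: hu => -[]. Qed.

Lemma differentiable_Dm m x : differentiable (Dm u m) x.
Proof. by case: hu => _ []. Qed.

Lemma differentiable_Dm_derivative y a m z :
  differentiable (Dm_derivative y a m) z.
Proof. by case: hu => _ [_ _ +] *; exact. Qed.

Lemma gradient_Dm_derivative y a m z b :
  gradient (Dm_derivative y a m) z 0 b = D2mm u m y z a b.
Proof. by rewrite [RHS]mxE. Qed.

(** The constant in the definition of the class carries no sign; its absolute value is taken, here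
    and in the next two bounds, so that inequalities can be multiplied by it. *)
Lemma Dm_growth : exists2 C : R, 0 <= C &
  forall m x, l2norm (Dm u m x) <= C * (1 + sqnorm x).
Proof.
case: hu => -[_ _ _ [C HC]] *; exists `|C| => // m x.
by apply: le_trans (HC m x) _; rewrite ler_wpM2r ?ler_norm// addr_ge0// sqnorm_ge0.
Qed.

Lemma DxDm_growth : exists2 C : R, 0 <= C &
  forall m x, l2norm (DxDm u m x) <= C * (1 + sqnorm x).
Proof.
case: hu => _ _ _ _ [C [HC _]]; exists `|C| => // m x.
by apply: le_trans (HC m x) _; rewrite ler_wpM2r ?ler_norm// addr_ge0// sqnorm_ge0.
Qed.

Lemma D2mm_growth : exists2 C : R, 0 <= C &
  forall m x y, l2norm (D2mm u m x y) <= C * (1 + sqnorm x + sqnorm y).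
Proof.
case: hu => _ _ _ _ [C [_ HC]]; exists `|C| => // m x y.
apply: le_trans (HC m x y) _; rewrite ler_wpM2r ?ler_norm//.
by rewrite !addr_ge0// sqnorm_ge0.
Qed.

Lemma measurable_Dm m a : measurable_fun setT (fun x => Dm u m x 0 a).
Proof.
apply: continuous_measurable_real => x.
have cD : {for x, continuous (Dm u m)}.
  by apply: differentiable_continuous; exact: differentiable_Dm.
exact: (cvg_comp _ _ cD (@coord_continuous R 1 n 0 a (Dm u m x))).
Qed.

Lemma integrable_Dm m mu a : mu.-integrable setT (EFin \o (fun x => Dm u m x 0 a)).
Proof.
have [C _ HC] := Dm_growth.
apply: (@integrable_growth _ _ _ _ C); first exact: measurable_Dm.
by move=> x; apply: le_trans (coord_le_l2norm _ _ _) (HC m x).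
Qed.

Lemma integrable_DxDm m mu a b :
  mu.-integrable setT (EFin \o (fun x => DxDm u m x a b)).
Proof.
have [C _ HC] := DxDm_growth.
apply: (@integrable_growth _ _ _ _ C); last first.
  by move=> x; apply: le_trans (coord_le_l2norm _ _ _) (HC m x).
apply: continuous_measurable_real => x; case: hu => _ _ cD _ _.
have cm := @continuous_pairr (P2 R n) T 'M[R]_n _ m cD.
exact: (cvg_comp _ _ (cm x) (@coord_continuous R n n a b (DxDm u m x))).
Qed.

(** The integrand is the normalised Taylor remainder [f_]. Pointwise it is half the form of [DxDm]
    at a point of the line tending to [x], which gives both its limit and its quadratic bound. *)
Lemma cvg_second_order_x m v (e_ : R^nat) : (forall k, 0 < e_ k <= 1) ->
  e_ @ \oo --> 0 ->
  (\int[m]_x (linear_derivative u m (x + e_ k *: v) - linear_derivative u m x)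
    - e_ k * dot v (\row_a \int[m]_x Dm u m x 0 a)) / e_ k ^+ 2 @[k --> \oo]
  --> 2^-1 * bilin v (\matrix_(a, b) \int[m]_x DxDm u m x a b) v.
Proof.
move=> e01 e_0; set d := linear_derivative u m.
have e_gt0 k : 0 < e_ k by have /andP[] := e01 k.
pose f_ k x := (d (x + e_ k *: v) - d x - e_ k * dot v (Dm u m x)) / e_ k ^+ 2.
have fE k x : exists t, 0 < t < e_ k /\
    f_ k x = 2^-1 * bilin v (DxDm u m (x + t *: v)) v.
  have [|t] := @line_taylor2 _ _ d x v _ (e_gt0 k) (differentiable_u m).
    exact: differentiable_Dm.
  rewrite in_itv/= => te tE; exists t; split => //.
  by rewrite /f_ [X in X / _]tE mulrC mulKf// expf_neq0// gt_eqF.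
have md : measurable_fun setT d.
  by apply: linear_derivative_measurable; exact: linear_derivative_u.
have id' mu : mu.-integrable setT (EFin \o d).
  by apply: linear_derivative_integrable; exact: linear_derivative_u.
have mf k : measurable_fun setT (f_ k).
  apply: measurable_funM => //; apply: measurable_funB.
    apply: measurable_funB => //; apply: (measurableT_comp (f := d)) => //.
    exact: measurable_shift.
  apply: measurable_funM => //; apply: measurable_dot => a.
  exact: measurable_Dm.
have [C C0 HC] := DxDm_growth.
(* The factor [2 + 2 * sqnorm v] comes from [sqnorm_line] and [1 + 2 X + 2 V <= (2 + 2 V) (1 + X)]
   for nonnegative [X] and [V]. *)
pose B := 2^-1 * (norm1 v * norm1 v * (C * (2 + 2 * sqnorm v))).
have fB k x : `|f_ k x| <= B * (1 + sqnorm x).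
  have [t [/andP[t0 te] ->]] := fE k x.
  rewrite normrM ger0_norm// /B -[leRHS]mulrA ler_wpM2l//.
  apply: le_trans (normr_bilin _ _ _) _; rewrite -[leRHS]mulrA ler_wpM2l//.
    by rewrite mulr_ge0// norm1_ge0.
  apply: le_trans (HC _ _) _; rewrite -[leRHS]mulrA ler_wpM2l//.
  have t1 : 0 <= t <= 1.
    by rewrite ltW//= (le_trans (ltW te))//; have /andP[] := e01 k.
  have := sqnorm_line x v t1; have := sqnorm_ge0 x; have := sqnorm_ge0 v.
  nra.
(* The intermediate points are chosen with [x] fixed, since only pointwise convergence is at stake
   here. *)
have f_cvg x : f_ k x @[k --> \oo] --> 2^-1 * bilin v (DxDm u m x) v.
  have [t_ tE] := choice (fE ^~ x).
  under eq_cvg => k do rewrite (tE k).2.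
  apply: cvgM; first exact: cvg_cst.
  apply: cvg_bilin => a b; apply: cvg_coord.
  have t0 := cvg_squeeze0 (fun k => (tE k).1) e_0.
  case: hu => _ _ cD _ _.
  exact: (@cvg_continuous_pair (P2 R n) T 'M[R]_n _ (fun=> m) _ m x cD
    (cvg_cst m) (@cvg_line _ _ x v t_ t0)).
have [_ _] := P2_dominated_cvg m mf fB f_cvg.
have iD k : m.-integrable setT (EFin \o (fun x => d (x + e_ k *: v) - d x)).
  by apply: integrable_subr => //; exact: integrable_shift.
have iDm k : m.-integrable setT (EFin \o (fun x => e_ k * dot v (Dm u m x))).
  by apply: integrable_cstM; apply: integrable_dot => a; exact: integrable_Dm.
rewrite RintegralZl//; last first.
  by apply: integrable_bilin => a b; exact: integrable_DxDm.
rewrite Rintegral_bilin; last by move=> a b; exact: integrable_DxDm.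
apply: cvg_trans; apply: near_eq_cvg; apply: nearW => k /=; rewrite /f_.
rewrite RintegralZr//; last exact: integrable_subr.
rewrite RintegralB// RintegralZl//; last first.
  by apply: integrable_dot => a; exact: integrable_Dm.
by rewrite Rintegral_dot// => a; exact: integrable_Dm.
Qed.

End ClassC2.

Lemma gradientB (R : realType) (n : nat) (f g : 'rV[R]_n -> R) (x : 'rV[R]_n) :
  differentiable f x -> differentiable g x ->
  gradient (fun y => f y - g y) x = gradient f x - gradient g x.
Proof.
move=> df dg; apply/rowP => a; rewrite !mxE.
by rewrite (@deriveB _ _ _ f g)//; exact: diff_derivable.
Qed.

(** * Limits of the integral over the second space variable *)

Section InnerLimit.
Context {R : realType} {n : nat}.
Let T := 'rV[R]_n.
Implicit Types (m mu : P2 R n) (x y z v : T).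
Variables (u : P2 R n -> R) (hu : classC2 u).

Lemma measurable_D2mm m y a b : measurable_fun setT (fun z => D2mm u m y z a b).
Proof.
apply: continuous_measurable_real => z; case: hu => _ _ _ cD _.
have cm := @continuous_pairr (P2 R n * T)%type T 'M[R]_n _ (m, y) cD.
exact: (cvg_comp _ _ (cm z) (@coord_continuous R n n a b (D2mm u m y z))).
Qed.

Lemma D2mm_coord_growth : exists2 C : R, 0 <= C & forall m x y a b,
  `|D2mm u m x y a b| <= C * (1 + sqnorm x) * (1 + sqnorm y).
Proof.
have [C C0 HC] := D2mm_growth hu; exists C => // m x y a b.
apply: le_trans (coord_le_l2norm _ _ _) _; apply: le_trans (HC m x y) _.
rewrite -mulrA ler_wpM2l//; have := sqnorm_ge0 x; have := sqnorm_ge0 y; nra.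
Qed.

Lemma integrable_D2mm m mu y a b :
  mu.-integrable setT (EFin \o (fun z => D2mm u m y z a b)).
Proof.
have [C C0 HC] := D2mm_coord_growth.
apply: (@integrable_growth _ _ _ _ (C * (1 + sqnorm y))) => //.
exact: measurable_D2mm.
Qed.

(** Measurability of the inner integral in [x] follows from its continuity, itself obtained by
    dominated convergence along sequences tending to [x]. *)
Lemma integrable_Rintegral_D2mm m mu a b :
  mu.-integrable setT (EFin \o (fun x => \int[m]_z D2mm u m x z a b)).
Proof.
have [C C0 HC] := D2mm_coord_growth.
apply: (@integrable_growth _ _ _ _ (C * (1 + \int[m]_z sqnorm z))); last first.
  move=> x; rewrite mulrAC; apply: normr_Rintegral_growth => //.
  exact: measurable_D2mm.
apply: continuous_measurable_real => x; apply: seq_continuous => y_ yx.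
have Ny : sqnorm (y_ k) @[k --> \oo] --> sqnorm x.
  rewrite /sqnorm; under eq_cvg do rewrite sql2normE; rewrite sql2normE.
  apply: cvg_sumr => l _; rewrite /GRing.exp/=.
  by apply: cvgM; exact: cvg_coord.
(* A convergent sequence is bounded: [M] gives a dominating function of [z] common to all [k]. *)
have /bounded_fun_has_ubound[M HM] : bounded_fun (fun k => sqnorm (y_ k)).
  by apply: cvg_seq_bounded; apply/cvg_ex; exists (sqnorm x).
have yM k : sqnorm (y_ k) <= M by apply: HM; exists k.
have mD k := @measurable_D2mm m (y_ k) a b.
have DB k z : `|D2mm u m (y_ k) z a b| <= C * (1 + M) * (1 + sqnorm z).
  apply: le_trans (HC m (y_ k) z a b) _.
  by rewrite ler_wpM2r ?addr_ge0 ?sqnorm_ge0// ler_wpM2l// lerD2l.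
have Dlim z : D2mm u m (y_ k) z a b @[k --> \oo] --> D2mm u m x z a b.
  apply: cvg_coord; case: hu => _ _ _ cD _.
  have cyz : (fun k => ((m, y_ k) : P2 R n * T)) @ \oo --> nbhs (m, x).
    exact: (@cvg_continuous_pair (P2 R n) T (P2 R n * T)%type id (fun=> m) _ m x
      (fun _ => cvg_id) (cvg_cst m) yx).
  exact: (@cvg_continuous_pair (P2 R n * T)%type T 'M[R]_n _ _ (fun=> z) _ z cD
    cyz (cvg_cst z)).
by have [] := P2_dominated_cvg m mD DB Dlim.
Qed.

(** This quotient is what gets integrated over [z]; the intermediate point of [quotientE] serves
    only for pointwise bounds and limits. *)
Let quotient mu y a v e z :=
  (Dm_derivative u y a mu (z + e *: v) - Dm_derivative u y a mu z) / e.

Let quotientE mu y a v e z : 0 < e -> exists2 t, 0 < t < e &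
  quotient mu y a v e z = dot v (\row_b D2mm u mu y (z + t *: v) a b).
Proof.
move=> e0; have [|t] := @line_MVT _ _ (Dm_derivative u y a mu) z v e e0.
  by move=> x; exact: differentiable_Dm_derivative.
rewrite in_itv/= => te tE; exists t => //.
rewrite /quotient tE mulrC mulKf ?gt_eqF//; congr dot.
by apply/rowP => b; rewrite gradient_Dm_derivative mxE.
Qed.

Let measurable_quotient mu y a v e : measurable_fun setT (quotient mu y a v e).
Proof.
have md := linear_derivative_measurable (Dm_derivativeP hu y a) mu.
apply: measurable_funM => //; apply: measurable_funB => //.
apply: (measurableT_comp (f := Dm_derivative u y a mu)) => //.
exact: measurable_shift.
Qed.

Let Rintegral_quotient m mu y a v e : \int[m]_z quotient mu y a v e z =
  (\int[m]_z (Dm_derivative u y a mu (z + e *: v) - Dm_derivative u y a mu z)) / e.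
Proof.
have id' := linear_derivative_integrable (Dm_derivativeP hu y a) mu.
rewrite RintegralZr//; apply: integrable_subr => //; apply: integrable_shift => //.
exact: linear_derivative_measurable (Dm_derivativeP hu y a) mu.
Qed.

Let quotient_growth : exists2 C : R, 0 <= C & forall mu y a v e z, 0 < e <= 1 ->
  `|quotient mu y a v e z| <=
  norm1 v * (C * (1 + sqnorm y) * (2 + 2 * sqnorm v)) * (1 + sqnorm z).
Proof.
have [C C0 HC] := D2mm_coord_growth; exists C => // mu y a v e z /andP[e0 e1].
have [t /andP[t0 te] ->] := quotientE mu y a v z e0.
rewrite -[leRHS]mulrA; apply: normr_dot => b; rewrite mxE.
apply: le_trans (HC _ _ _ _ _) _.
rewrite -[leRHS]mulrA ler_wpM2l//; first by rewrite mulr_ge0// addr_ge0// sqnorm_ge0.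
have t1 : 0 <= t <= 1 by rewrite ltW//= (le_trans (ltW te)).
have := sqnorm_line z v t1; have := sqnorm_ge0 z; have := sqnorm_ge0 v; nra.
Qed.

(** The constant does not depend on [mu] and the growth in [y] is quadratic: this dominates the
    outer integrand, where [y] lies near the outer variable and [mu] on a segment. *)
Lemma Dm_derivative_shift_growth m : exists2 C : R, 0 <= C &
  forall mu y a v e, 0 < e <= 1 ->
  `|(\int[m]_z (Dm_derivative u y a mu (z + e *: v) -
      Dm_derivative u y a mu z)) / e| <=
  C * norm1 v * (2 + 2 * sqnorm v) * (1 + sqnorm y).
Proof.
have [C C0 HC] := quotient_growth.
have S0 : 0 <= \int[m]_z sqnorm z by apply: Rintegral_ge0 => z _; exact: sqnorm_ge0.
exists (C * (1 + \int[m]_z sqnorm z)) => [|mu y a v e e01].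
  by rewrite mulr_ge0// addr_ge0.
rewrite -Rintegral_quotient.
apply: le_trans (normr_Rintegral_growth m (measurable_quotient _ _ _ _ _)
  (fun z => HC mu y a v e z e01)) _.
by rewrite le_eqVlt; apply/orP; left; apply/eqP; ring.
Qed.

(** Measure, base point and step move together, which the joint continuity of [D2mm] allows; [M]
    keeps the dominating function independent of [k]. *)
Lemma cvg_Dm_derivative_shift m x a v (mu_ : (P2 R n)^nat) (y_ : T^nat)
    (e_ : R^nat) (M : R) : (forall k, 0 < e_ k <= 1) -> e_ @ \oo --> 0 ->
  mu_ @ \oo --> m -> y_ @ \oo --> nbhs x -> (forall k, sqnorm (y_ k) <= M) ->
  (\int[m]_z (Dm_derivative u (y_ k) a (mu_ k) (z + e_ k *: v) -
      Dm_derivative u (y_ k) a (mu_ k) z)) / e_ k @[k --> \oo] -->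
  dot v (\row_b \int[m]_z D2mm u m x z a b).
Proof.
move=> e01 e0 mum yx yM; under eq_cvg do rewrite -Rintegral_quotient.
have [C C0 HC] := quotient_growth.
have mq k := @measurable_quotient (mu_ k) (y_ k) a v (e_ k).
have qlim z : quotient (mu_ k) (y_ k) a v (e_ k) z @[k --> \oo] -->
    dot v (\row_b D2mm u m x z a b).
  have e_gt0 k : 0 < e_ k by have /andP[] := e01 k.
  have tE k : exists t, 0 < t < e_ k /\ quotient (mu_ k) (y_ k) a v (e_ k) z =
      dot v (\row_b D2mm u (mu_ k) (y_ k) (z + t *: v) a b).
    by have [t] := quotientE (mu_ k) (y_ k) a v z (e_gt0 k); exists t.
  have {tE}[t_ tE] := choice tE.
  rewrite dotE; under eq_cvg => k do rewrite (tE k).2 dotE.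
  apply: cvg_sumr => b _; rewrite mxE; under eq_cvg do rewrite mxE.
  apply: cvgM; first exact: cvg_cst.
  apply: cvg_coord; case: hu => _ _ _ cD _.
  have t0 := cvg_squeeze0 (fun k => (tE k).1) e0.
  have cyz : (fun k => ((mu_ k, y_ k) : P2 R n * T)) @ \oo --> nbhs (m, x).
    exact: (@cvg_continuous_pair (P2 R n) T (P2 R n * T)%type id mu_ _ m x
      (fun _ => cvg_id) mum yx).
  exact: (@cvg_continuous_pair (P2 R n * T)%type T 'M[R]_n _ _ _ _ z cD
    cyz (@cvg_line _ _ z v t_ t0)).
have qB k z : `|quotient (mu_ k) (y_ k) a v (e_ k) z| <=
    norm1 v * (C * (1 + M) * (2 + 2 * sqnorm v)) * (1 + sqnorm z).
  apply: le_trans (HC _ _ _ _ _ _ (e01 k)) _.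
  rewrite ler_wpM2r ?addr_ge0 ?sqnorm_ge0// ler_wpM2l ?norm1_ge0//.
  apply: ler_wpM2r; first by rewrite addr_ge0// mulr_ge0// sqnorm_ge0.
  by rewrite ler_wpM2l// lerD2l.
have [_ _] := P2_dominated_cvg m mq qB qlim.
rewrite (@Rintegral_dot _ _ m v (fun z => \row_b D2mm u m x z a b)); last first.
  move=> b; under [X in _ \o X]eq_fun do rewrite mxE; exact: integrable_D2mm.
rewrite (_ : \row_b _ = \row_b \int[m]_z D2mm u m x z a b)//.
apply/rowP => b; rewrite !mxE; apply: eq_Rintegral => z _; by rewrite mxE.
Qed.

End InnerLimit.

(** * The term in [R], and the expansion along a sequence of mixtures *)

Section OuterLimit.
Context {R : realType} {n : nat} {I : finType}.
Let T := 'rV[R]_n.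
Implicit Types (x y z : T).
Variables (u : P2 R n -> R) (hu : classC2 u).
Variables (P : pred I) (w : I -> {nonneg R}) (v : I -> T) (m : P2 R n).
Hypothesis w1 : \sum_(i | P i) (w i)%:num = 1.

Lemma segment_slope_mixture V d (mu : P2 R n) (e h : R) :
  is_linear_derivative V d -> mixture P w (fun i => e *: v i) m mu ->
  segment_slope d m mu h = \sum_(i | P i) (w i)%:num *
    \int[m]_x (d (segment m mu h) (x + e *: v i) - d (segment m mu h) x).
Proof.
move=> dV mmu; apply: (Rintegral_mixtureB mmu) => //.
- exact: linear_derivative_measurable dV _.
- exact: linear_derivative_integrable dV _.
Qed.

Variables (mu_ : (P2 R n)^nat) (e_ : R^nat).
Hypotheses (mmu : forall k, mixture P w (fun i => e_ k *: v i) m (mu_ k))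
  (e01 : forall k, 0 < e_ k <= 1) (e_0 : e_ @ \oo --> 0).

Local Notation dU := (linear_derivative u).
Local Notation J x := (\matrix_(a, b) \int[m]_z D2mm u m x z a b).

Let e_gt0 k : 0 < e_ k. Proof. by have /andP[] := e01 k. Qed.

(* Two mean value theorems, along [x + s *: v'] and then along the segment from
   [m] to [mu_ k], turn the mixed second difference of [u] into slopes of the
   components of [Dm u]. *)
Let mixed_differenceE (xi_ : R^nat) v' k x : (forall k, 0 < xi_ k < 1) ->
  exists p : R * ('I_n -> R), [/\ 0 < p.1 < e_ k, forall a, 0 <= p.2 a <= 1 &
  ((dU (segment m (mu_ k) (xi_ k)) (x + e_ k *: v') -
    dU (segment m (mu_ k) (xi_ k)) x) - (dU m (x + e_ k *: v') - dU m x))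
    / (xi_ k * e_ k ^+ 2) =
  \sum_a v' 0 a * \sum_(i | P i) (w i)%:num *
    ((\int[m]_z (Dm_derivative u (x + p.1 *: v') a
        (segment m (mu_ k) (p.2 a)) (z + e_ k *: v i) -
      Dm_derivative u (x + p.1 *: v') a (segment m (mu_ k) (p.2 a)) z)) / e_ k)].
Proof.
move=> xi01; set mux := segment m (mu_ k) (xi_ k).
have [xi0 xi1] : 0 < xi_ k /\ xi_ k < 1 by apply/andP.
have du mu y : differentiable (dU mu) y by exact: differentiable_u.
(* Applied to the difference of the two functions, the mean value theorem gives one point [t] for
   both measures. *)
have [|t] := @line_MVT _ _ (fun y => dU mux y - dU m y) x v' _ (e_gt0 k).
  by move=> y; exact: differentiableB.
rewrite in_itv/= => te tE.
pose y := x + t *: v'.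
(* Each component needs its own parameter [s], whence the family [p.2]; the factor [xi_ k] appearing
   here cancels the one in the divisor. *)
have slopeE a : exists s, 0 <= s <= 1 /\ Dm u mux y 0 a - Dm u m y 0 a =
    xi_ k * segment_slope (Dm_derivative u y a) m (mu_ k) s.
  have xi01k : 0 < xi_ k <= 1 by rewrite xi0 ltW.
  have [s /andP[s0 sxi] E] :=
    segment_MVT (Dm_derivativeP hu y a) m (mu_ k) xi01k.
  by exists s; split => //; rewrite ltW// ltW// (lt_trans sxi).
have [s_ sE] := choice slopeE.
exists (t, s_); split => //=; first by move=> a; have [] := sE a.
have -> : dU mux (x + e_ k *: v') - dU mux x - (dU m (x + e_ k *: v') - dU m x) =
    e_ k * dot v' (Dm u mux y - Dm u m y).
  by rewrite -gradientB// -tE; ring.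
rewrite dotE mulr_sumr mulr_suml; apply: eq_bigr => a _.
rewrite mxE [X in _ + X]mxE (sE a).2.
rewrite (segment_slope_mixture _ (Dm_derivativeP hu y a) (mmu k)).
under [in RHS]eq_bigr do rewrite mulrA.
rewrite -mulr_suml -/y; field.
by rewrite !lt0r_neq0.
Qed.

(** The mean value theorem along the segment produces the factor [xi_ k] that the divisor removes,
    so the limit is the same for every choice of [xi_]. *)
Lemma cvg_second_order_m (xi_ : R^nat) v' : (forall k, 0 < xi_ k < 1) ->
  (\int[m]_x (dU (segment m (mu_ k) (xi_ k)) (x + e_ k *: v') -
    dU (segment m (mu_ k) (xi_ k)) x) -
   \int[m]_x (dU m (x + e_ k *: v') - dU m x)) / (xi_ k * e_ k ^+ 2)
   @[k --> \oo] -->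
  \sum_(i | P i) (w i)%:num * bilin v'
    (\matrix_(a, b) \int[m]_x (\int[m]_y D2mm u m x y a b)) (v i).
Proof.
move=> xi01.
pose f_ k x := ((dU (segment m (mu_ k) (xi_ k)) (x + e_ k *: v') -
    dU (segment m (mu_ k) (xi_ k)) x) - (dU m (x + e_ k *: v') - dU m x))
    / (xi_ k * e_ k ^+ 2).
have md mu := linear_derivative_measurable (linear_derivative_u hu) mu.
have id' mu := linear_derivative_integrable (linear_derivative_u hu) mu.
have mdB mu k : measurable_fun setT (fun x => dU mu (x + e_ k *: v') - dU mu x).
  apply: measurable_funB => //; apply: (measurableT_comp (f := dU mu)) => //.
  exact: measurable_shift.
have idB mu k : m.-integrable setT
    (EFin \o (fun x => dU mu (x + e_ k *: v') - dU mu x)).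
  by apply: integrable_subr => //; exact: integrable_shift.
have mf k : measurable_fun setT (f_ k).
  by apply: measurable_funM => //; exact: measurable_funB.
have [C C0 HC] := Dm_derivative_shift_growth hu m.
have N0 := @sqnorm_ge0 R n; have n0 := @norm1_ge0 R n.
have line_growth k x t : 0 < t < e_ k ->
    sqnorm (x + t *: v') <= 2 * sqnorm x + 2 * sqnorm v'.
  move=> /andP[t0 te]; apply: sqnorm_line; rewrite ltW//= (le_trans (ltW te))//.
  by have /andP[] := e01 k.
(* Each summand is the bound of [Dm_derivative_shift_growth]; its last factor accounts for the base
   point [x + t *: v'] through [line_growth]. *)
pose B := \sum_a `|v' 0 a| * \sum_(i | P i) (w i)%:num *
  (C * norm1 (v i) * (2 + 2 * sqnorm (v i)) * (2 + 2 * sqnorm v')).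
have fB k x : `|f_ k x| <= B * (1 + sqnorm x).
  have [[t s_] /= [te s01 fE]] := mixed_differenceE v' k x xi01.
  rewrite /f_ fE /B mulr_suml; apply: le_trans (ler_norm_sum _ _ _) _.
  apply: ler_sum => a _; rewrite normrM -[leRHS]mulrA ler_wpM2l//.
  rewrite mulr_suml; apply: le_trans (ler_norm_sum _ _ _) _.
  apply: ler_sum => i _; rewrite normrM ger0_norm// -[leRHS]mulrA ler_wpM2l//.
  apply: le_trans (HC _ _ _ _ _ (e01 k)) _.
  rewrite -[leRHS]mulrA ler_wpM2l//.
    by rewrite !mulr_ge0// addr_ge0// mulr_ge0.
  have := line_growth k x t te; have := N0 x; have := N0 v'; nra.
have f_cvg x : f_ k x @[k --> \oo] -->
    \sum_(i | P i) (w i)%:num * bilin v' (J x) (v i).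
  have [p_ pE] := choice (fun k => mixed_differenceE v' k x xi01).
  (* The limit is regrouped by components of [v'], the shape in which [mixed_differenceE] presents
     [f_]. *)
  rewrite (_ : \sum_(i | P i) _ = \sum_a v' 0 a * \sum_(i | P i) (w i)%:num *
    dot (v i) (\row_b \int[m]_z D2mm u m x z a b)); last first.
    under [RHS]eq_bigr do rewrite mulr_sumr.
    rewrite exchange_big/=; apply: eq_bigr => i _; rewrite bilinE mulr_sumr.
    apply: eq_bigr => a _; rewrite dotE !mulr_sumr; apply: eq_bigr => b _.
    by rewrite !mxE; ring.
  have fE k : f_ k x = \sum_a v' 0 a * \sum_(i | P i) (w i)%:num *
      ((\int[m]_z (Dm_derivative u (x + (p_ k).1 *: v') a
        (segment m (mu_ k) ((p_ k).2 a)) (z + e_ k *: v i) -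
      Dm_derivative u (x + (p_ k).1 *: v') a (segment m (mu_ k) ((p_ k).2 a)) z))
        / e_ k).
    by have [] := pE k.
  under eq_cvg do rewrite fE.
  have t_0 : (fun k => (p_ k).1) @ \oo --> 0.
    by apply: cvg_squeeze0 e_0 => k; have [] := pE k.
  apply: cvg_sumr => a _; apply: cvgM; first exact: cvg_cst.
  apply: cvg_sumr => i _; apply: cvgM; first exact: cvg_cst.
  apply: (@cvg_Dm_derivative_shift _ _ _ hu m x a (v i)
    (fun k => segment m (mu_ k) ((p_ k).2 a)) (fun k => x + (p_ k).1 *: v') e_
    (2 * sqnorm x + 2 * sqnorm v') e01 e_0).
  - by apply: (cvg_segment_mixture mmu w1) => // k; have [] := pE k.
  - exact: cvg_line.
  - by move=> k; apply: (line_growth k); have [] := pE k.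
have [_ _] := P2_dominated_cvg m mf fB f_cvg.
have iJ i : m.-integrable setT (EFin \o (fun x => bilin v' (J x) (v i))).
  apply: integrable_bilin => a b; under [X in _ \o X]eq_fun do rewrite mxE.
  exact: integrable_Rintegral_D2mm.
rewrite Rintegral_sum => [|i _]; last exact: integrable_cstM.
rewrite (eq_bigr (fun i => (w i)%:num * bilin v'
    (\matrix_(a, b) \int[m]_x (\int[m]_y D2mm u m x y a b)) (v i))); last first.
  move=> i _; rewrite RintegralZl// Rintegral_bilin; last first.
    move=> a b; under [X in _ \o X]eq_fun do rewrite mxE.
    exact: integrable_Rintegral_D2mm.
  congr (_ * bilin _ _ _); apply/matrixP => a b; rewrite !mxE.
  by apply: eq_Rintegral => x _; rewrite mxE.
apply: cvg_trans; apply: near_eq_cvg; apply: nearW => k /=; rewrite /f_.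
by rewrite RintegralZr//; [rewrite RintegralB//|exact: integrable_subr].
Qed.

Lemma cvg_mixture_expansion :
  (u (mu_ k) - u m - e_ k * dot (\sum_(i | P i) (w i)%:num *: v i)
    (\row_a \int[m]_x Dm u m x 0 a)) / e_ k ^+ 2 @[k --> \oo] -->
  2^-1 * (\sum_(j | P j) (w j)%:num *
    bilin (v j) (\matrix_(a, b) \int[m]_x DxDm u m x a b) (v j)) +
  2^-1 * (\sum_(k | P k) \sum_(j | P j) (w j)%:num * (w k)%:num *
    bilin (v j) (\matrix_(a, b) \int[m]_x (\int[m]_y D2mm u m x y a b)) (v k)).
Proof.
pose slope k h := segment_slope dU m (mu_ k) h.
have xiE k : exists t, 0 < t < 1 /\ u (mu_ k) - u m - slope k 0 =
    (slope k t - slope k 0) / (2 * t).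
  have [t t01 tE] := segment_second_order (linear_derivative_u hu) m (mu_ k).
  by exists t.
have [xi_ {}xiE] := choice xiE.
have xi01 k := (xiE k).1.
pose d1 k j := \int[m]_x (dU m (x + e_ k *: v j) - dU m x).
pose dxi k j := \int[m]_x (dU (segment m (mu_ k) (xi_ k)) (x + e_ k *: v j) -
    dU (segment m (mu_ k) (xi_ k)) x).
pose p := \row_a \int[m]_x Dm u m x 0 a.
(* The outer [2^-1] is that of the divisor [2 * t] in Cauchy's theorem and belongs to the term in
   [R]; the one of the term in [Q] arises in the limit of the first sum. *)
have splitE k : (u (mu_ k) - u m - e_ k * dot (\sum_(i | P i) (w i)%:num *: v i)
    p) / e_ k ^+ 2 =
    \sum_(j | P j) (w j)%:num * ((d1 k j - e_ k * dot (v j) p) / e_ k ^+ 2) +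
    2^-1 * \sum_(j | P j) (w j)%:num *
      ((dxi k j - d1 k j) / (xi_ k * e_ k ^+ 2)).
  have slope0 : slope k 0 = \sum_(j | P j) (w j)%:num * d1 k j.
    rewrite /slope (segment_slope_mixture _ (linear_derivative_u hu) (mmu k)).
    by rewrite segment0.
  have slopexi : slope k (xi_ k) = \sum_(j | P j) (w j)%:num * dxi k j.
    exact: segment_slope_mixture (linear_derivative_u hu) (mmu k).
  have -> : dot (\sum_(i | P i) (w i)%:num *: v i) p =
      \sum_(j | P j) (w j)%:num * dot (v j) p.
    rewrite /dot mulmx_suml summxE; apply: eq_bigr => j _.
    by rewrite -scalemxAl mxE.
  have -> : \sum_(j | P j) (w j)%:num * ((d1 k j - e_ k * dot (v j) p) / e_ k ^+ 2) =
      (slope k 0 - e_ k * \sum_(j | P j) (w j)%:num * dot (v j) p) / e_ k ^+ 2.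
    rewrite slope0 mulr_sumr -sumrB mulr_suml; apply: eq_bigr => j _; ring.
  have -> : \sum_(j | P j) (w j)%:num * ((dxi k j - d1 k j) / (xi_ k * e_ k ^+ 2)) =
      (slope k (xi_ k) - slope k 0) / (xi_ k * e_ k ^+ 2).
    rewrite slope0 slopexi -sumrB mulr_suml; apply: eq_bigr => j _; ring.
  have := (xiE k).2; move/(canRL (subrK _)) ->.
  have [xi0 _] := andP (xi01 k).
  by field; rewrite !lt0r_neq0.
under eq_cvg do rewrite splitE.
apply: cvgD.
  rewrite mulr_sumr; apply: cvg_sumr => j _; rewrite mulrCA.
  by apply: cvgM; [exact: cvg_cst|exact: cvg_second_order_x].
apply: cvgM; first exact: cvg_cst.
(* The sums are swapped so that the direction [v j], acting on the outer variable, is fixed first,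
   as in [cvg_second_order_m]. *)
rewrite exchange_big/=; apply: cvg_sumr => j _.
under eq_bigr do rewrite -mulrA; rewrite -mulr_sumr.
by apply: cvgM; [exact: cvg_cst|exact: cvg_second_order_m].
Qed.

End OuterLimit.

(** * From sequences to a real parameter tending to infinity *)

Section RealLimit.
Context {R : realType} {n : nat} {I : finType}.
Variables (u : P2 R n -> R) (hu : classC2 u).
Variables (P : pred I) (w : I -> {nonneg R}) (v : I -> 'rV[R]_n) (m : P2 R n).
Hypothesis w1 : \sum_(i | P i) (w i)%:num = 1.
Variable mu : R -> P2 R n.
Hypothesis mmu : forall s, s != 0 -> mixture P w (fun i => s^-1 *: v i) m (mu s).

Lemma mixture_expansion :
  (fun t : R => t * (u (mu (Num.sqrt t)) - u m - (Num.sqrt t)^-1 *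
    dot (\sum_(i | P i) (w i)%:num *: v i) (\row_a \int[m]_x Dm u m x 0 a)))
  @ +oo -->
  2^-1 * (\sum_(j | P j) (w j)%:num *
    bilin (v j) (\matrix_(a, b) \int[m]_x DxDm u m x a b) (v j)) +
  2^-1 * (\sum_(k | P k) \sum_(j | P j) (w j)%:num * (w k)%:num *
    bilin (v j) (\matrix_(a, b) \int[m]_x (\int[m]_y D2mm u m x y a b)) (v k)).
Proof.
apply/cvg_pinftyP => t_ ty.
(* Dropping the first [N] terms leaves the limit unchanged and ensures [t >= 1], so that the step
   [e_ k], the inverse square root of [t k], lies in [(0, 1]]. *)
have [N _ tN] : \forall k \near \oo, 1 <= t_ k.
  by have /cvgryPge := ty; exact.
rewrite -(cvg_shiftn N).
pose t k := t_ (k + N)%N.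
have t1 k : 1 <= t k by apply: tN; rewrite /= leq_addl.
have t0 k : 0 < t k by exact: lt_le_trans (t1 k).
have s0 k : 0 < Num.sqrt (t k) by rewrite sqrtr_gt0.
pose e_ k := (Num.sqrt (t k))^-1.
have e01 k : 0 < e_ k <= 1.
  rewrite invr_gt0 s0/= invf_le1// -[leLHS]sqrtr1 ler_sqrt//.
  exact: ltW.
have e_0 : e_ @ \oo --> 0.
  apply/cvgrPdist_lt => e e0.
  have /cvgryPgt /(_ (e ^- 2)) : t @ \oo --> +oo by rewrite cvg_shiftn.
  apply: filterS => k tk; rewrite sub0r normrN gtr0_norm ?invr_gt0//.
  rewrite invf_plt ?posrE// -[ltLHS]gtr0_norm ?invr_gt0// -sqrtr_sqr.
  by rewrite ltr_sqrt// exprVn.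
have := cvg_mixture_expansion hu w1 (mu_ := fun k => mu (Num.sqrt (t k)))
  (e_ := e_) (v := v) (m := m) _ e01 e_0.
have mk k : mixture P w (fun i => e_ k *: v i) m (mu (Num.sqrt (t k))).
  by apply: mmu; rewrite lt0r_neq0.
move=> /(_ mk); apply: cvg_trans; apply: near_eq_cvg; apply: nearW => k /=.
rewrite /e_ -/(t k) exprVn invrK sqr_sqrtr ?ltW// mulrC; congr (_ * _).
Qed.

End RealLimit.

Section SignedForms.
Context {R : realType} {n : nat}.
Implicit Types (v w : 'rV[R]_n).

Lemma dotNl v w : dot (- v) w = - dot v w.
Proof. by rewrite /dot mulNmx mxE. Qed.

Lemma bilinNN v (M : 'M[R]_n) w : bilin (- v) M (- w) = bilin v M w.
Proof. by rewrite /bilin linearN mulNmx mulmxN mulNmx opprK. Qed.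

End SignedForms.

Theorem proposition3p2 (R : realType) (K : nat) (hK : (2 <= K)%N)
    (u : P2 R K -> R) (hu : classC2 u) (m : P2 R K) (a : cubeP R K)
    (i : 'I_K) :
  let p : 'rV[R]_K := \row_k \int[m]_x Dm u m x 0 k in
  let Q : 'M[R]_K := \matrix_(k, l) \int[m]_x DxDm u m x k l in
  let Rm : 'M[R]_K :=
    \matrix_(k, l) \int[m]_x (\int[m]_y D2mm u m x y k l) in
  (forall h : 0 < hatp a i,
    (fun T : R => T * (u (Ap m h (Num.sqrt T)) - u m
                       + (Num.sqrt T)^-1 * dot (Vp a i) p)) @ +oo -->
      2^-1 * (\sum_(j : {set 'I_K} | i \in j)
        a j / hatp a i * bilin (evec (~: j)) Q (evec (~: j)))
      + 2^-1 * (\sum_(k : {set 'I_K} | i \in k) \sum_(j : {set 'I_K} | i \in j)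
        a j / hatp a i * (a k / hatp a i)
          * bilin (evec (~: j)) Rm (evec (~: k)))) /\
  (forall h : 0 < hatn a i,
    (fun T : R => T * (u (An m h (Num.sqrt T)) - u m
                       - (Num.sqrt T)^-1 * dot (Vn a i) p)) @ +oo -->
      2^-1 * (\sum_(j : {set 'I_K} | i \notin j)
        a j / hatn a i * bilin (evec j) Q (evec j))
      + 2^-1 * (\sum_(k : {set 'I_K} | i \notin k)
                  \sum_(j : {set 'I_K} | i \notin j)
        a j / hatn a i * (a k / hatn a i) * bilin (evec j) Rm (evec k))).
Proof.
move=> p Q Rm; split => h.
- have w1 : \sum_(j : {set 'I_K} | i \in j) (NngNum (wp_ge0 a i j))%:num = 1.
    by rewrite /= -mulr_suml divff// gt_eqF.
  have mAp s : s != 0 -> mixture (fun j : {set 'I_K} => i \in j)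
      (fun j => NngNum (wp_ge0 a i j)) (fun j => s^-1 *: - evec (~: j)) m
      (Ap m h s).
    by move=> s0; apply: dilated_mixture => // A mA; exact: P2_ofE.
  have VpE : \sum_(j : {set 'I_K} | i \in j) (a j / hatp a i) *: - evec (~: j) =
      - Vp a i.
    by under eq_bigr do rewrite scalerN; rewrite sumrN.
  (* The translations are by [- evec (~: j)]: the sign turns the linear correction into a sum and
     cancels in both quadratic terms. *)
  have := mixture_expansion hu w1 mAp; rewrite /= VpE.
  under [X in 2^-1 * X + 2^-1 * _]eq_bigr do rewrite bilinNN.
  under [X in 2^-1 * _ + 2^-1 * X]eq_bigr do under eq_bigr do rewrite bilinNN.
  by under eq_fun do rewrite dotNl mulrN opprK.
- have w1 : \sum_(j : {set 'I_K} | i \notin j) (NngNum (wn_ge0 a i j))%:num = 1.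
    by rewrite /= -mulr_suml divff// gt_eqF.
  have mAn s : s != 0 -> mixture (fun j : {set 'I_K} => i \notin j)
      (fun j => NngNum (wn_ge0 a i j)) (fun j => s^-1 *: evec j) m (An m h s).
    by move=> s0; apply: dilated_mixture => // A mA; exact: P2_ofE.
  by have := mixture_expansion hu w1 mAn.
Qed.
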